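(* For every integer $k>1$ there are infinitely many distinct (pairwise non-isomorphic as complex manifolds) deformations of $W_k$.
   Context: For $k\geq 1$, $W_k=\mathrm{Tot}(\mathcal{O}_{\mathbb{P}^1}(-k)\oplus\mathcal{O}_{\mathbb{P}^1}(k-2))$ is the complex threefold obtained by gluing $U=\mathbb{C}^3_{\{z,u_1,u_2\}}$ and $V=\mathbb{C}^3_{\{\xi,v_1,v_2\}}$ by $(\xi,v_1,v_2)=(z^{-1},z^ku_1,z^{-k+2}u_2)$ for $z,\xi\neq 0$. A deformation family of a complex manifold $X$ is a holomorphic surjective submersion $\pi\colon\tilde X\to D$, where $D$ is a complex disc centered at $0$ (possibly a vector space, possibly infinite dimensional), such that $\pi^{-1}(0)=X$ and $\tilde X$ is locally trivial over $D$ in the $C^\infty$ category. The fibers $X_t=\pi^{-1}(t)$ are called deformations of $X$. *)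

(* Defs.v *)
From HB Require Import structures.
From mathcomp Require Import all_boot all_order all_algebra.
From mathcomp Require Import generic_quotient complex.
From mathcomp Require Import all_classical all_reals all_analysis.

Set Implicit Arguments.
Unset Strict Implicit.
Unset Printing Implicit Defensive.

Import Order.TTheory GRing.Theory Num.Theory.
Import numFieldNormedType.Exports.

Local Open Scope classical_set_scope.
Local Open Scope ring_scope.
Local Open Scope quotient_scope.

(* R[i], sealed as a numClosedFieldType so that the topology and norm of
   numFieldNormedType.Exports are inferred on it and on its matrices. *)
Definition Cplx (R : realType) : numClosedFieldType := R[i].

(** ** Real C^oo maps between open subsets of complex normed spaces *)

Section RealSmoothness.
Variable R : realType.
Notation C := (Cplx R).

(* The increment h is real: this is the derivative of f in the direction v for
   the underlying real normed spaces. *)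
Definition real_quotient (E F : normedModType C) (f : E -> F) (x v : E) (h : R)
    : F :=
  (real_complex R h : C)^-1 *: (f (x + (real_complex R h : C) *: v) - f x).

Definition real_derivable (E F : normedModType C) (f : E -> F) (x v : E) : Prop :=
  cvg (real_quotient f x v h @[h --> (0 : R)^']).

Definition real_derive (E F : normedModType C) (f : E -> F) (x v : E) : F :=
  lim (real_quotient f x v h @[h --> (0 : R)^']).

(* C^n on an open set U in the sense of Michal and Bastiani: f is C^(n+1) when
   it is continuous, all its directional derivatives exist on U, and
   (x, v) |-> df(x; v) is C^n on U x E.  In finite dimension this is the usual
   notion, and between arbitrary normed spaces it has the usual C^oo maps. *)
Fixpoint Cn_on (n : nat) (E F : normedModType C) (U : set E) (f : E -> F)
    : Prop :=
  (forall x, U x -> {for x, continuous f}) /\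
  (if n is m.+1 then
     (forall x v, U x -> real_derivable f x v) /\
     @Cn_on m (E * E)%type F (U `*` [set: E])
       (fun p => real_derive f p.1 p.2)
   else True).

Definition smooth_near (E F : normedModType C) (f : E -> F) (x : E) : Prop :=
  exists U : set E, [/\ open U, U x & forall n, Cn_on n U f].

End RealSmoothness.

(** ** Complex manifolds modelled on a complex normed space *)

Section Manifolds.
Variable R : realType.
Notation C := (Cplx R).

(* [chart_inv] is only meaningful on the image of [chart_dom]. *)
Record chart (E : normedModType C) (M : topologicalType) := Chart {
  chart_dom : set M;
  chart_fun :> M -> E;
  chart_inv : E -> M }.

Record is_chart (E : normedModType C) (M : topologicalType) (c : chart E M)
    : Prop := IsChart {
  chart_dom_open : open (chart_dom c);
  chart_cod_open : open (c @` chart_dom c);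
  chart_funK : {in chart_dom c, cancel c (chart_inv c)};
  chart_fun_continuous :
    forall x, chart_dom c x -> {for x, continuous c};
  chart_inv_continuous :
    forall y, (c @` chart_dom c) y -> {for y, continuous (chart_inv c)} }.

Record atlased (E : normedModType C) := Atlased {
  points :> topologicalType;
  atlas : set (chart E points) }.
Arguments atlas {E} M _ : rename.

(* Second countability is demanded whenever the model space itself is second
   countable, in particular in finite dimension. *)
Record is_complex_manifold (E : normedModType C) (M : atlased E)
    : Prop := IsComplexManifold {
  manifold_hausdorff : hausdorff_space M;
  manifold_second_countable : @second_countable E -> @second_countable M;
  manifold_charts : forall c, atlas M c -> is_chart c;
  manifold_cover : forall x : M, exists2 c, atlas M c & chart_dom c x;
  manifold_transitions : forall c d, atlas M c -> atlas M d ->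
    forall x, chart_dom c x -> chart_dom d x ->
      differentiable (d \o chart_inv c) (c x) }.

Definition model (E : normedModType C) : atlased E :=
  Atlased [set Chart [set: E] id id].

Definition product_chart (E F : normedModType C) (M N : topologicalType)
    (c : chart E M) (d : chart F N) : chart (E * F)%type (M * N)%type :=
  Chart (chart_dom c `*` chart_dom d)
        (fun p => (c p.1, d p.2))
        (fun q => (chart_inv c q.1, chart_inv d q.2)).

Definition product_mfd (E F : normedModType C) (M : atlased E) (N : atlased F)
    : atlased (E * F)%type :=
  Atlased [set e | exists c d, [/\ atlas M c, atlas N d & e = product_chart c d]].

(* On the set A (open in all uses), every coordinate expression of f satisfies
   the pointwise property P. *)
Definition in_charts (E F : normedModType C) (M : atlased E) (N : atlased F)
    (P : (E -> F) -> E -> Prop) (A : set M) (f : M -> N) : Prop :=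
  forall c d, atlas M c -> atlas N d ->
  forall x, A x -> chart_dom c x -> chart_dom d (f x) ->
    P (d \o f \o chart_inv c) (c x).

(* [differentiable] over the field C is complex Frechet differentiability. *)
Definition holomorphic (E F : normedModType C) (M : atlased E) (N : atlased F)
    (f : M -> N) : Prop :=
  continuous f /\
  in_charts (fun g y => differentiable g y) [set: M] f.

Definition smooth_on (E F : normedModType C) (M : atlased E) (N : atlased F)
    (A : set M) (f : M -> N) : Prop :=
  (forall x, A x -> {for x, continuous f}) /\
  in_charts (@smooth_near R E F) A f.

Definition submersion (E F : normedModType C) (M : atlased E) (N : atlased F)
    (f : M -> N) : Prop :=
  in_charts (fun g y => forall w : F, exists v : E, 'd g y v = w) [set: M] f.

Definition immersion (E F : normedModType C) (M : atlased E) (N : atlased F)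
    (f : M -> N) : Prop :=
  in_charts (fun g y => injective ('d g y : E -> F)) [set: M] f.

Definition topological_embedding (S T : topologicalType) (f : S -> T) : Prop :=
  [/\ continuous f, injective f &
      forall U : set S, open U -> exists2 V : set T, open V & f @^-1` V = U].

Definition biholomorphic (E F : normedModType C) (M : atlased E) (N : atlased F)
    : Prop :=
  exists (f : M -> N) (g : N -> M),
    [/\ holomorphic f, holomorphic g, cancel f g & cancel g f].

(** ** Deformations *)

(* Y is the fibre of p over t, with the complex structure induced by X:
   a complex manifold holomorphically embedded in X with image p^-1(t). *)
Definition is_fiber (E F : normedModType C) (X : atlased F) (B : normedModType C)
    (p : X -> B) (t : B) (Y : atlased E) : Prop :=
  is_complex_manifold Y /\
  exists j : Y -> X,
    [/\ holomorphic j, topological_embedding j, immersion j &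
        range j = p @^-1` [set t]].

Definition disc_or_space (B : normedModType C) (D : set B) : Prop :=
  D = [set: B] \/ exists2 r : C, 0 < r & D = ball (0 : B) r.

(* A C^oo trivialization of p over A, with fibre X. *)
Definition smooth_trivialization (E F : normedModType C) (X : atlased E)
    (XX : atlased F) (B : normedModType C) (p : XX -> B) (A : set B)
    (f : XX -> product_mfd X (model B)) (g : product_mfd X (model B) -> XX) : Prop :=
  [/\ smooth_on (p @^-1` A) f,
      smooth_on (M := product_mfd X (model B)) ([set: X] `*` A) g,
      forall y : XX, A (p y) -> (f y).2 = p y /\ g (f y) = y &
      forall q : product_mfd X (model B), A q.2 -> p (g q) = q.2 /\ f (g q) = q].

Record deformation_family (E F : normedModType C) (X : atlased E)
    (XX : atlased F) (B : normedModType C) (D : set B) (p : XX -> B)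
    : Prop := DeformationFamily {
  family_base : disc_or_space D;
  family_manifold : is_complex_manifold XX;
  family_holomorphic : holomorphic (N := model B) p;
  family_submersion : submersion (N := model B) p;
  family_surjective : range p = D;
  family_central_fiber : is_fiber p 0 X;
  family_locally_trivial : forall t, D t ->
    exists A : set B, [/\ open A, A t, A `<=` D &
      exists f g, smooth_trivialization (X := X) p A f g] }.

(* Banach, as a predicate because the library has no completeNormedModType
   instances over R[i]. *)
Definition complete_normed (E : normedModType C) : Prop :=
  forall G : set_system E, ProperFilter G -> cauchy G -> cvg G.

(* The base may be infinite dimensional; the base and the model of the total
   space are then complex Banach spaces. *)
Definition is_deformation (E : normedModType C) (X Y : atlased E) : Prop :=
  exists (F B : normedModType C) (XX : atlased F) (D : set B) (p : XX -> B)
         (t : B),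
    [/\ complete_normed F, complete_normed B,
        deformation_family X D p, D t & is_fiber p t Y].

End Manifolds.

(** ** The threefolds W_k *)

Section Threefold.
Variables (R : realType) (k : nat).
Notation C := (Cplx R).

Definition vec3 (a b c : C) : 'rV[C]_3 := \row_(i < 3) [:: a; b; c]`_i.

(* (z, u1, u2) |-> (z^-1, z^k u1, z^(-k+2) u2); where z <> 0 its inverse,
   from V to U, is given by the same formula. *)
Definition W_glue (x : 'rV[C]_3) : 'rV[C]_3 :=
  vec3 (x 0 0)^-1 (x 0 0 ^+ k * x 0 1) (x 0 0 ^ (- k%:Z + 2) * x 0 2).

(* The disjoint union of U and V is bool * C^3, with U = {true} * C^3. *)
Definition W_rel (p q : bool * 'rV[C]_3) : bool :=
  [|| p == q,
      [&& p.1, ~~ q.1, p.2 0 0 != 0 & q.2 == W_glue p.2] |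
      [&& q.1, ~~ p.1, q.2 0 0 != 0 & p.2 == W_glue q.2]].

Lemma vec3E (a b c : C) :
  (vec3 a b c 0 0 = a) * (vec3 a b c 0 1 = b) * (vec3 a b c 0 2 = c).
Proof. by rewrite !mxE. Qed.

Lemma vec3_eta (x : 'rV[C]_3) : vec3 (x 0 0) (x 0 1) (x 0 2) = x.
Proof.
apply/rowP => i; rewrite mxE.
by case: i => [[|[|[|//]]]] Hi /=; congr (x 0 _); apply/val_inj.
Qed.

Lemma W_glueK (x : 'rV[C]_3) : x 0 0 != 0 -> W_glue (W_glue x) = x.
Proof.
move=> z0; rewrite -[RHS]vec3_eta /W_glue !vec3E invrK; congr vec3.
  by rewrite mulrA -exprMn mulVf // expr1n mul1r.
by rewrite mulrA exprz_inv -expfzDr // addNr expr0z mul1r.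
Qed.

Lemma W_glue_neq0 (x : 'rV[C]_3) : (W_glue x 0 0 != 0) = (x 0 0 != 0).
Proof. by rewrite /W_glue !vec3E invr_eq0. Qed.

Lemma W_rel_equiv : equiv_class_of W_rel.
Proof.
split.
- by move=> p; rewrite /W_rel eqxx.
- by move=> p q; rewrite /W_rel eq_sym [X in _ || X]orbC.
- move=> q p r; rewrite /W_rel.
  case/or3P => [/eqP -> //|/and4P[p1 q1 p0 /eqP pq]|/and4P[q1 p1 q0 /eqP qp]].
    case/or3P => [/eqP <-|/and4P[]|/and4P[r1 _ r0 /eqP qr]].
    + by rewrite p1 q1 p0 pq eqxx orbT.
    + by rewrite (negPf q1).
    + have e : p.2 = r.2 by rewrite -(W_glueK p0) -pq qr W_glueK.
      by apply/orP; left; rewrite [p]surjective_pairing [r]surjective_pairing p1 r1 e.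
  case/or3P => [/eqP <-|/and4P[_ r1 _ /eqP rq]|/and4P[_]].
  + by rewrite q1 p1 q0 qp eqxx !orbT.
  + apply/orP; left; rewrite [p]surjective_pairing [r]surjective_pairing.
    by rewrite (negPf p1) (negPf r1) qp rq.
  + by rewrite q1.
Qed.

Canonical W_equiv_rel := EquivRelPack W_rel_equiv.

Definition W_space : topologicalType :=
  quotient_topology {eq_quot W_equiv_rel}.

Definition W_class (p : bool * 'rV[C]_3) : W_space :=
  \pi_({eq_quot W_equiv_rel}) p.

(* The coordinates (z, u1, u2) if b = true, (xi, v1, v2) if b = false. *)
Definition W_chart (b : bool) : chart 'rV[C]_3 W_space :=
  Chart (range (fun x => W_class (b, x)))
        (fun w => let p := repr (w : {eq_quot W_equiv_rel}) in
                  if p.1 == b then p.2 else W_glue p.2)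
        (fun x => W_class (b, x)).

Definition W : atlased 'rV[C]_3 :=
  Atlased [set W_chart true; W_chart false].

End Threefold.

(* Main.v *)
Require Import Defs.
From mathcomp Require Import all_boot all_order all_algebra.
From mathcomp Require Import ring lra.
From mathcomp Require Import generic_quotient complex.
From mathcomp Require Import all_classical all_reals all_analysis.

Set Implicit Arguments.
Unset Strict Implicit.
Unset Printing Implicit Defensive.

Import Order.TTheory GRing.Theory Num.Theory.
Import numFieldNormedType.Exports.

Local Open Scope classical_set_scope.
Local Open Scope ring_scope.
Local Open Scope quotient_scope.

(** Why there are infinitely many deformations.  Put r_n(y) = y (y - 1) ... (y - n + 1) and, for
each complex number t, glue two copies of C^3 by
   xi = 1/z,   v1 = z^k u1 + t (z^2 u2 + t z r_n(u1)),   v2 = z^(2-k) u2 + t z^(1-k) r_n(u1).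
The fibre t = 0 is W_k, and the fibre t = 1 is the n-th deformation X_n.

The formula comes from two steps.  The bundle O(k-2) is a quotient of O(-2) + O with kernel O(-k),
so W_2 is a deformation of W_k; and W_2, which is a family over the y-line of copies of Tot O(-2),
deforms further by replacing the surface over y by an affine quadric whenever r_n(y) <> 0.  Indeed
y = xi^k v1 - t v2 = u1 is a function on every fibre, and at t = 1 the coordinates
w = u2 + z^(k-2) u1 and w' = v1 turn the gluing into xi = 1/z, w' = z^2 w + z r_n(y), y' = y.

Telling the X_n apart.  By a Liouville theorem a holomorphic map from the Riemann sphere to X_n
makes the four global functions y, w, zw and w' constant.  They separate points, except on
the n curves w = zw = w' = 0, y = i with 0 <= i < n ([global_fun_separates]).  Hence the image of
every nonconstant sphere in X_n lies on one of these n curves, which are spheres themselves.  If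
n < m, a biholomorphism from X_m to X_n sends two of the m curves of X_m into the same curve of
X_n, and the inverse image of the latter is a sphere in X_m on which y takes two values, which is
absurd ([no_biholomorphism]).

The Liouville theorem ([sphere_function_constant]) is proved for maps that are only assumed complex
differentiable at each point.  If f is entire with limit l at infinity, f o exp is periodic, and
Goursat's theorem on the rectangle [-L, L] x [0, 2 pi] ([goursat_rectangle]) equates its means over
the two vertical sides, which tend to f 0 and to l.

Smooth triviality.  The family is straightened by an explicit change of coordinates on each chart,
obtained by splitting the gluing cocycles with the partition of unity made of 1/(1 + |z|^(2k)) and
|z|^(2k)/(1 + |z|^(2k)).  Multiplied by |z|^(2k), the negative powers of z that occur become
polynomials in z and its conjugate, so that every formula is a rational function of
the coordinates and their conjugates whose denominator has no zeros.  Its smoothness follows from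
the closure of the C^n functions under sums, products, inverses and conjugation.

Manifolds, fibres and trivializations are handled for arbitrary manifolds glued from two copies of
a normed space ([glue_data]), of which W_k, its deformations and the total space are instances. *)

(** * Bisection of rectangles *)

Section Bisect.
Variable R : realType.

Lemma halving_limit (a : R) (x : nat -> R) : 0 <= a ->
  (forall n, x n <= x n.+1 /\ x n.+1 + a / 2 ^+ n.+1 <= x n + a / 2 ^+ n) ->
  exists l, forall n, x n <= l <= x n + a / 2 ^+ n.
Proof.
move=> a0 H.
have pos n : 0 <= a / 2 ^+ n by rewrite divr_ge0 // exprn_ge0.
have inc : forall m n, (m <= n)%N -> x m <= x n.
  move=> m n /subnK <-; elim: (n - m)%N => [//|i IH].
  by apply: le_trans IH _; rewrite addSn; have [] := H (i + m)%N.
have dec : forall m n, (m <= n)%N -> x n + a / 2 ^+ n <= x m + a / 2 ^+ m.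
  move=> m n /subnK <-; elim: (n - m)%N => [//|i IH].
  by apply: le_trans IH; rewrite addSn; have [] := H (i + m)%N.
have ub n m : x m <= x n + a / 2 ^+ n.
  case: (leqP m n) => [mn|/ltnW nm].
    by apply: le_trans (inc _ _ mn) _; rewrite lerDl.
  by apply: le_trans (dec _ _ nm); rewrite lerDl.
exists (sup (range x)) => n; apply/andP; split.
  apply: sup_upper_bound; last by exists n.
  split; first by exists (x 0%N); exists 0%N.
  by exists (x 0%N + a / 2 ^+ 0) => _ [m _ <-]; exact: ub.
by apply: ge_sup; [exists (x 0%N); exists 0%N|move=> _ [m _ <-]; exact: ub].
Qed.

(** Goursat's bisection for an arbitrary subadditive function I of rectangles: keeping at each
step the quarter where I is largest gives nested rectangles, of sides a / 2^n and b / 2^n,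
shrinking to the point (l, m), on which I decreases at most like 4^-n. *)
Lemma quadrisection (a b x0 y0 : R) (I : R -> R -> nat -> R) :
  0 <= a -> 0 <= b ->
  (forall x y n, let u := a / 2 ^+ n.+1 in let v := b / 2 ^+ n.+1 in
    I x y n <= I x y n.+1 + I (x + u) y n.+1
             + I x (y + v) n.+1 + I (x + u) (y + v) n.+1) ->
  exists (l m : R) (x y : nat -> R), forall n,
    [/\ I x0 y0 0 <= 4 ^+ n * I (x n) (y n) n,
        x n <= l <= x n + a / 2 ^+ n,
        y n <= m <= y n + b / 2 ^+ n,
        (x0 <= x n) && (x n + a / 2 ^+ n <= x0 + a) &
        (y0 <= y n) && (y n + b / 2 ^+ n <= y0 + b)].
Proof.
move=> a0 b0 sub.
have hs (c : R) n : c / 2 ^+ n = c / 2 ^+ n.+1 + c / 2 ^+ n.+1.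
  have h0 : (2 : R) ^+ n != 0 by rewrite expf_neq0.
  by rewrite exprS; field.
have pos (c : R) n : 0 <= c -> 0 <= c / 2 ^+ n.
  by move=> c0; rewrite divr_ge0 // exprn_ge0.
have step (q : R * R * nat) : exists p : R * R * nat,
    [/\ p.2 = q.2.+1, I q.1.1 q.1.2 q.2 <= 4 * I p.1.1 p.1.2 q.2.+1,
     (q.1.1 <= p.1.1) && (p.1.1 <= q.1.1 + a / 2 ^+ q.2.+1) &
     (q.1.2 <= p.1.2) && (p.1.2 <= q.1.2 + b / 2 ^+ q.2.+1)].
  case: q => -[x y] n /=; have := sub x y n => /=.
  have u0 := pos a n.+1 a0; have v0 := pos b n.+1 b0.
  set u := a / _ in u0 *; set v := b / _ in v0 *.
  set A := I x y n.+1; set B := I (x + u) y n.+1; set D := I x (y + v) n.+1.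
  set E := I (x + u) (y + v) n.+1 => le4.
  have [hA|hA] := leP (I x y n) (4 * A).
    by exists (x, y, n.+1); split=> //=; apply/andP; split; lra.
  have [hB|hB] := leP (I x y n) (4 * B).
    by exists (x + u, y, n.+1); split=> //=; apply/andP; split; lra.
  have [hD|hD] := leP (I x y n) (4 * D).
    by exists (x, y + v, n.+1); split=> //=; apply/andP; split; lra.
  exists (x + u, y + v, n.+1); split=> //=; last 2 first.
  - by apply/andP; split; lra.
  - by apply/andP; split; lra.
  by rewrite -/E; lra.
have [f Pf] := choice step.
pose s n := iter n f (x0, y0, 0%N).
have s2 n : (s n).2 = n by elim: n => // n IH; rewrite /s iterS -/(s n);
  have [-> _ _ _] := Pf (s n); rewrite IH.
pose x n := (s n).1.1; pose y n := (s n).1.2.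
have P n : [/\ I (x n) (y n) n <= 4 * I (x n.+1) (y n.+1) n.+1,
     (x n <= x n.+1) && (x n.+1 <= x n + a / 2 ^+ n.+1) &
     (y n <= y n.+1) && (y n.+1 <= y n + b / 2 ^+ n.+1)].
  by have := Pf (s n); rewrite /x /y s2 /= -/(s n.+1); case.
have Hx n : x n <= x n.+1 /\ x n.+1 + a / 2 ^+ n.+1 <= x n + a / 2 ^+ n.
  have [_ /andP[h1 h2] _] := P n; split=> //.
  by rewrite (hs a n) addrA lerD2r.
have Hy n : y n <= y n.+1 /\ y n.+1 + b / 2 ^+ n.+1 <= y n + b / 2 ^+ n.
  have [_ _ /andP[h1 h2]] := P n; split=> //.
  by rewrite (hs b n) addrA lerD2r.
have [l Hl] := halving_limit a0 Hx.
have [m Hm] := halving_limit b0 Hy.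
exists l, m, x, y => n; split=> //.
- elim: n => [|n IH]; first by rewrite expr0 mul1r.
  apply: le_trans IH _; rewrite exprS mulrC -mulrA [4 * _]mulrC -mulrA.
  rewrite [X in X <= _]mulrC ler_wpM2l ?exprn_ge0 // mulrC.
  by have [] := P n.
- elim: n => [|n /andP[h1 h2]]; first by rewrite expr0 divr1 !lexx.
  by have [h3 h4] := Hx n; apply/andP; split; lra.
- elim: n => [|n /andP[h1 h2]]; first by rewrite expr0 divr1 !lexx.
  by have [h3 h4] := Hy n; apply/andP; split; lra.
Qed.

End Bisect.

(** * Complex numbers as pairs of reals *)

Section ComplexBasics.
Variable R : realType.
Notation C := (Cplx R).

(** An alias of [real_complex R] with values in the sealed type of complex numbers, so that its
topology and norm are found by unification. *)
Definition ofR (x : R) : C := real_complex R x.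
Definition rePart (z : C) : R := complex.Re z.
Definition imPart (z : C) : R := complex.Im z.
Definition iC : C := Complex (0 : R) 1.
(** The modulus as a real number; the norm of the complex numbers takes complex values. *)
Definition cmod (z : C) : R := rePart `|z|.

Lemma ofRD x y : ofR (x + y) = ofR x + ofR y. Proof. exact: (rmorphD (real_complex R)). Qed.
Lemma ofRN x : ofR (- x) = - ofR x. Proof. exact: (rmorphN (real_complex R)). Qed.
Lemma ofRB x y : ofR (x - y) = ofR x - ofR y. Proof. by rewrite ofRD ofRN. Qed.
Lemma ofRM x y : ofR (x * y) = ofR x * ofR y. Proof. exact: (rmorphM (real_complex R)). Qed.
Lemma ofR0 : ofR 0 = 0. Proof. by []. Qed.
Lemma ofR1 : ofR 1 = 1. Proof. by []. Qed.
Lemma ofR_inj : injective ofR. Proof. exact: complexI. Qed.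
Lemma ofR_eq0 x : (ofR x == 0) = (x == 0).
Proof. by rewrite -(inj_eq ofR_inj) ofR0. Qed.
Lemma ofRV x : ofR x^-1 = (ofR x)^-1. Proof. exact: (fmorphV (real_complex R)). Qed.
Lemma ofR_le x y : (ofR x <= ofR y) = (x <= y). Proof. exact: lecR. Qed.
Lemma ofR_lt x y : (ofR x < ofR y) = (x < y). Proof. exact: ltcR. Qed.

Lemma ReD z w : rePart (z + w) = rePart z + rePart w. Proof. by case: z; case: w. Qed.
Lemma ImD z w : imPart (z + w) = imPart z + imPart w. Proof. by case: z; case: w. Qed.
Lemma ReN z : rePart (- z) = - rePart z. Proof. by case: z. Qed.
Lemma ImN z : imPart (- z) = - imPart z. Proof. by case: z. Qed.
Lemma ReM z w : rePart (z * w) = rePart z * rePart w - imPart z * imPart w.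
Proof. by case: z; case: w. Qed.
Lemma ImM z w : imPart (z * w) = rePart z * imPart w + imPart z * rePart w.
Proof. by case: z => a b; case: w => c d; rewrite /imPart /rePart /= addrC. Qed.
Lemma ReofR x : rePart (ofR x) = x. Proof. by []. Qed.
Lemma ImofR x : imPart (ofR x) = 0. Proof. by []. Qed.
Lemma Re_iC : rePart iC = 0. Proof. by []. Qed.
Lemma Im_iC : imPart iC = 1. Proof. by []. Qed.
Lemma complex_ext z w : rePart z = rePart w -> imPart z = imPart w -> z = w.
Proof. by case: z => a b; case: w => c d; rewrite /imPart /rePart /= => -> ->. Qed.
Lemma complexReIm z : z = ofR (rePart z) + iC * ofR (imPart z).
Proof. by apply: complex_ext; rewrite ?(ReD, ImD, ReM, ImM) /=;
  rewrite ?(ReofR, ImofR, Re_iC, Im_iC); ring. Qed.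
Lemma iC2 : iC * iC = -1. Proof. by apply: complex_ext; rewrite /rePart /imPart /=; ring. Qed.

Lemma cmodE z : `|z| = ofR (cmod z).
Proof. by rewrite /cmod (normc_def (z : R[i])). Qed.
Lemma cmod_sqrt z : cmod z = Num.sqrt (rePart z ^+ 2 + imPart z ^+ 2).
Proof. by rewrite /cmod (normc_def (z : R[i])). Qed.
Lemma cmod_ge0 z : 0 <= cmod z. Proof. by rewrite cmod_sqrt sqrtr_ge0. Qed.
Lemma cmod0 : cmod 0 = 0. Proof. by rewrite /cmod normr0. Qed.
Lemma cmod1 : cmod 1 = 1. Proof. by rewrite /cmod normr1. Qed.
Lemma cmod_eq0 z : (cmod z == 0) = (z == 0).
Proof. by rewrite -ofR_eq0 -cmodE normr_eq0. Qed.
Lemma cmodN z : cmod (- z) = cmod z. Proof. by rewrite /cmod normrN. Qed.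
Lemma cmodC z w : cmod (z - w) = cmod (w - z). Proof. by rewrite -cmodN opprB. Qed.
Lemma cmodM z w : cmod (z * w) = cmod z * cmod w.
Proof. by apply: ofR_inj; rewrite ofRM -!cmodE normrM. Qed.
Lemma cmodD z w : cmod (z + w) <= cmod z + cmod w.
Proof. by rewrite -ofR_le ofRD -!cmodE ler_normD. Qed.
Lemma cmodB z w : cmod (z - w) <= cmod z + cmod w.
Proof. by rewrite -(cmodN w); exact: cmodD. Qed.
Lemma cmodofR x : cmod (ofR x) = `|x|.
Proof. by rewrite cmod_sqrt ReofR ImofR expr0n addr0 sqrtr_sqr. Qed.
Lemma cmodi : cmod iC = 1.
Proof. by rewrite cmod_sqrt Re_iC Im_iC expr0n add0r expr1n sqrtr1. Qed.
Lemma cmod_leReIm z : cmod z <= `|rePart z| + `|imPart z|.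
Proof.
by rewrite {1}(complexReIm z); apply: le_trans (cmodD _ _) _; rewrite cmodM cmodi mul1r !cmodofR.
Qed.
Lemma Re_le_cmod z : `|rePart z| <= cmod z.
Proof. by rewrite cmod_sqrt -sqrtr_sqr ler_wsqrtr // lerDl sqr_ge0. Qed.
Lemma Im_le_cmod z : `|imPart z| <= cmod z.
Proof. by rewrite cmod_sqrt -sqrtr_sqr ler_wsqrtr // lerDr sqr_ge0. Qed.

Lemma pos_ofR (e : C) : 0 < e -> exists2 e' : R, 0 < e' & e = ofR e'.
Proof.
move=> e0; exists (rePart e); last first.
  have : e \is Num.real by apply: gtr0_real.
  by move=> /complex_realP [x ->].
by move: e0; rewrite ltcE => /andP[].
Qed.

Lemma cvg_cmodP (T : Type) (F : set_system T) (FF : Filter F) (f : T -> C) (l : C) :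
  (forall e : R, 0 < e -> \forall t \near F, cmod (f t - l) < e) <-> (f @ F --> l).
Proof.
split=> [H|H e e0].
  apply/cvgrPdist_lt => e /pos_ofR[e' e0 ->].
  by apply: filterS (H _ e0) => t; rewrite cmodE ofR_lt cmodC.
have /cvgrPdist_lt /(_ (ofR e)) := H.
by rewrite -ofR0 ofR_lt => /(_ e0); apply: filterS => t; rewrite cmodE ofR_lt cmodC.
Qed.

(** Balls of the complex numbers have complex radii; this restates neighbourhoods with real
ones. *)
Lemma near_cmodP (z : C) (P : set C) :
  (\forall w \near z, P w) <-> exists2 d : R, 0 < d & forall w, cmod (w - z) < d -> P w.
Proof.
split=> [/nbhs_ballP [e /= /pos_ofR[d d0 ->] H]|[d d0 H]].
  by exists d => // w wz; apply: H; rewrite -ball_normE /= cmodE ofR_lt cmodC.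
apply/nbhs_ballP; exists (ofR d) => /=; first by rewrite -ofR0 ofR_lt.
by move=> w; rewrite -ball_normE /= cmodE ofR_lt cmodC; exact: H.
Qed.

Lemma ofR_continuous : continuous ofR.
Proof.
move=> x; apply/cvg_cmodP => e e0.
have : (fun y : R => y) @ x --> x by exact: cvg_id.
move/cvgrPdist_lt => /(_ _ e0); apply: filterS => y.
by rewrite -ofRB cmodofR distrC.
Qed.

Lemma rePart_continuous : continuous rePart.
Proof.
move=> z; have F : Filter (nbhs z) by exact _.
apply/cvgrPdist_lt => e e0.
apply/near_cmodP; exists e => // y; rewrite cmodC; apply: le_lt_trans.
by rewrite -ReN -ReD Re_le_cmod.
Qed.

Lemma imPart_continuous : continuous imPart.
Proof.
move=> z; have F : Filter (nbhs z) by exact _.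
apply/cvgrPdist_lt => e e0.
apply/near_cmodP; exists e => // y; rewrite cmodC; apply: le_lt_trans.
by rewrite -ImN -ImD Im_le_cmod.
Qed.

(** The form of complex differentiability that Goursat's argument uses. *)
Lemma differentiable_epsilon (f : C -> C) (p : C) : differentiable f p ->
  exists d : C, forall e : R, 0 < e -> exists2 r : R, 0 < r &
    forall w, cmod (w - p) < r -> cmod (f w - f p - d * (w - p)) <= e * cmod (w - p).
Proof.
move=> df; exists ('d f p 1) => e e0.
have /eqaddoP := diff_locally df => /(_ (ofR e)).
rewrite -ofR0 ofR_lt => /(_ e0) /near_cmodP [r r0 H]; exists r => // w wp.
have := H (w - p); rewrite subr0 => /(_ wp).
rewrite /= !fctE /= subrK cmodE cmodE -ofRM ofR_le; apply: le_trans.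
rewrite opprD addrA.
suff -> : 'd f p 1 * (w - p) = 'd f p (w - p) by [].
have -> : 'd f p (w - p) = 'd f p ((w - p) *: (1 : C)) by congr ('d f p _);
  rewrite -[RHS]/(_ * _) mulr1.
by rewrite linearZ mulrC.
Qed.

End ComplexBasics.

(** * Antiderivatives of continuous functions of a real variable *)

Section Prim.
Variable R : realType.
Notation C := (Cplx R).
Local Notation mu := (@lebesgue_measure R).

(** The antiderivative is the integral from a, hence the restriction to x > a. *)
Lemma real_primitive (g : R -> R) (a : R) : continuous g ->
  exists G : R -> R, forall x, a < x -> is_derive x 1 G (g x).
Proof.
move=> cg; exists (fun x => \int[mu]_(t in `[a, x]) g t)%R => x ax.
have I : mu.-integrable `[a, x + 1] (EFin \o g).
  apply: continuous_compact_integrable; first exact: segment_compact.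
  exact: continuous_subspaceT.
have xx : x < x + 1 by rewrite ltrDl.
have [D E] := continuous_FTC1_closed xx I ax (cg x).
by split; [exact: D|rewrite -derive1E; exact: E].
Qed.

(** Contour integrals are written as increments of antiderivatives: their additivity is then an
identity in a ring, and their estimates are instances of the mean value theorem. *)
Definition antiderivative (a : R) (G g : R -> C) := forall x, a < x ->
  is_derive x (1 : R) (@rePart R \o G) (rePart (g x)) /\
  is_derive x (1 : R) (@imPart R \o G) (imPart (g x)).

Lemma exists_antiderivative (a : R) (g : R -> C) : continuous g -> exists G, antiderivative a G g.
Proof.
move=> cg.
have [G1 H1] : exists G : R -> R, forall x, a < x -> is_derive x 1 G (rePart (g x)).
  apply: real_primitive => x; apply: continuous_comp; first exact: cg.
  exact: rePart_continuous.
have [G2 H2] : exists G : R -> R, forall x, a < x -> is_derive x 1 G (imPart (g x)).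
  apply: real_primitive => x; apply: continuous_comp; first exact: cg.
  exact: imPart_continuous.
exists (fun x => Complex (G1 x) (G2 x)) => x ax; split.
  exact: H1.
exact: H2.
Qed.

Lemma real_increment_close (G H g h : R -> R) (a x1 x2 K : R) :
  (forall x, a < x -> is_derive x 1 G (g x)) ->
  (forall x, a < x -> is_derive x 1 H (h x)) ->
  a < x1 -> x1 <= x2 -> (forall x, x1 <= x <= x2 -> `|g x - h x| <= K) ->
  `|(G x2 - G x1) - (H x2 - H x1)| <= K * (x2 - x1).
Proof.
move=> dG dH ax1 x12 HK.
have dD x : a < x -> is_derive x 1 (G - H) (g x - h x).
  by move=> ax; have := dG x ax; have := dH x ax => ? ?; exact: is_deriveB.
have [x||c] := @MVT_segment R (G - H) (fun x => g x - h x) x1 x2 x12.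
- by rewrite in_itv /= => /andP[x1x _]; apply: dD; apply: lt_trans x1x.
- apply: derivable_within_continuous => x; rewrite in_itv /= => /andP[x1x _].
  by have [] := dD x (lt_le_trans ax1 x1x).
rewrite in_itv /= => cI E.
have -> : G x2 - G x1 - (H x2 - H x1) = (G - H) x2 - (G - H) x1.
  by rewrite !fctE; ring.
rewrite E normrM [X in _ * X]ger0_norm ?subr_ge0 // ler_wpM2r ?subr_ge0 //.
exact: HK.
Qed.

(** The estimate of an integral by the supremum of the integrand, the factor 2 being the cost of
treating real and imaginary parts separately. *)
Lemma increment_close (G H g h : R -> C) (a x1 x2 K : R) :
  antiderivative a G g -> antiderivative a H h -> a < x1 -> x1 <= x2 ->
  (forall x, x1 <= x <= x2 -> cmod (g x - h x) <= K) ->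
  cmod ((G x2 - G x1) - (H x2 - H x1)) <= 2 * K * (x2 - x1).
Proof.
move=> pG pH ax x12 HK.
apply: le_trans (cmod_leReIm _) _; rewrite -mulrA mulr2n mulrDl mul1r lerD //.
  rewrite !(ReD, ReN).
  apply: (@real_increment_close (@rePart R \o G) (@rePart R \o H)
    (fun x => rePart (g x)) (fun x => rePart (h x)) a) => //.
  - by move=> x /pG[].
  - by move=> x /pH[].
  - move=> x xI; rewrite -ReN -ReD; apply: le_trans (Re_le_cmod _) _; exact: HK.
rewrite !(ImD, ImN).
apply: (@real_increment_close (@imPart R \o G) (@imPart R \o H)
    (fun x => imPart (g x)) (fun x => imPart (h x)) a) => //.
- by move=> x /pG[].
- by move=> x /pH[].
- move=> x xI; rewrite -ImN -ImD; apply: le_trans (Im_le_cmod _) _; exact: HK.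
Qed.

Lemma is_derive_affine_square (p q x : R) :
  is_derive x 1 (fun x => p * x + q * (x ^+ 2 / 2)) (p + q * x).
Proof.
have -> : (fun x => p * x + q * (x ^+ 2 / 2)) = p \*: id + (q / 2) \*: (id ^+ 2).
  by apply/funext => t; rewrite !fctE /= /GRing.scale /= ; field.
by apply: is_derive_eq; rewrite /GRing.scale /= expr1; field.
Qed.

Lemma antiderivative_affine (a : R) (p q : C) :
  antiderivative a (fun x => p * ofR x + q * (ofR (x ^+ 2 / 2))) (fun x => p + q * ofR x).
Proof.
move=> x ax; split.
  have -> : @rePart R \o (fun x => p * ofR x + q * (ofR (x ^+ 2 / 2))) =
    (fun x => rePart p * x + rePart q * (x ^+ 2 / 2)).
    by apply/funext => t; rewrite /= ReD !ReM !ReofR !ImofR !mulr0 !subr0.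
  rewrite ReD ReM ReofR ImofR mulr0 subr0; exact: is_derive_affine_square.
have -> : @imPart R \o (fun x => p * ofR x + q * (ofR (x ^+ 2 / 2))) =
    (fun x => imPart p * x + imPart q * (x ^+ 2 / 2)).
  by apply/funext => t; rewrite /= ImD !ImM !ReofR !ImofR !mulr0 !add0r.
rewrite ImD ImM ReofR ImofR mulr0 add0r; exact: is_derive_affine_square.
Qed.

End Prim.

(** * Goursat's theorem *)

Section Goursat.
Variable R : realType.
Notation C := (Cplx R).
Variable f : C -> C.
Hypothesis df : forall z, differentiable f z.

Local Notation "x +i y" := (ofR x + @iC R * ofR y) (at level 50).

Lemma continuous_row (y : R) : continuous (fun x : R => f (x +i y)).
Proof.
move=> x; apply: (@continuous_comp _ _ _ (fun x : R => x +i y) f).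
  by apply: cvgD; [exact: ofR_continuous|exact: cvg_cst].
exact: differentiable_continuous (df _).
Qed.

Lemma continuous_column (x : R) : continuous (fun y : R => f (x +i y)).
Proof.
move=> y; apply: (@continuous_comp _ _ _ (fun y : R => x +i y) f).
  apply: cvgD; first exact: cvg_cst.
  by apply: cvgM; [exact: cvg_cst|exact: ofR_continuous].
exact: differentiable_continuous (df _).
Qed.

(** The four increments are the integrals of f over the sides of a rectangle. On the small
rectangles of [quadrisection], f differs from an affine function, whose contour integral
vanishes, by at most e times half the perimeter; the contour integral is thus at most 4 e times
the square of a + b after rescaling, for all e > 0. *)
Theorem goursat_rectangle (x0 y0 a b a0 b0 : R) (H V : R -> R -> C) :
  a0 < x0 -> b0 < y0 -> 0 <= a -> 0 <= b ->
  (forall y, antiderivative a0 (H y) (fun x => f (x +i y))) ->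
  (forall x, antiderivative b0 (V x) (fun y => f (x +i y))) ->
  (H y0 (x0 + a) - H y0 x0) + iC R * (V (x0 + a) (y0 + b) - V (x0 + a) y0)
  = (H (y0 + b) (x0 + a) - H (y0 + b) x0) + iC R * (V x0 (y0 + b) - V x0 y0).
Proof.
move=> ax by0 a_ge b_ge pH pV.
pose oint x y u v : C := (H y (x + u) - H y x) + iC R * (V (x + u) (y + v) - V (x + u) y)
  - ((H (y + v) (x + u) - H (y + v) x) + iC R * (V x (y + v) - V x y)).
apply/eqP; rewrite -subr_eq0 -/(oint x0 y0 a b) -cmod_eq0.
pose I x y n := cmod (oint x y (a / 2 ^+ n) (b / 2 ^+ n)).
have sub x y n : let u := a / 2 ^+ n.+1 in let v := b / 2 ^+ n.+1 in
    I x y n <= I x y n.+1 + I (x + u) y n.+1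
             + I x (y + v) n.+1 + I (x + u) (y + v) n.+1.
  move=> u v.
  have hs (c : R) : c / 2 ^+ n = c / 2 ^+ n.+1 + c / 2 ^+ n.+1.
    have h0 : (2 : R) ^+ n != 0 by rewrite expf_neq0.
    by rewrite exprS; field.
  have -> : I x y n = cmod (oint x y u v + oint (x + u) y u v
       + oint x (y + v) u v + oint (x + u) (y + v) u v).
    rewrite /I (hs a) (hs b) -/u -/v /oint !addrA; congr cmod; ring.
  by rewrite /I -/u -/v; do 3! (apply: le_trans (cmodD _ _) _; rewrite lerD2r).
(* f is approximated by its affine part at the limit point l + i m. *)
have [l [m [x [y P]]]] := quadrisection x0 y0 a_ge b_ge sub.
have [d Hd] := differentiable_epsilon (df (l +i m)).
have key (e : R) : 0 < e -> cmod (oint x0 y0 a b) <= 4 * e * (a + b) ^+ 2.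
  move=> e0; have [r r0 Hr] := Hd e e0.
  (* The rectangles eventually lie in the disc where the approximation holds. *)
  have [n Hn] : exists n, (a + b) / 2 ^+ n < r.
    exists (Num.truncn ((a + b) / r)).+1.
    rewrite ltr_pdivrMr ?exprn_gt0 // mulrC -ltr_pdivrMr //.
    apply: lt_le_trans (truncnS_gt _) _.
    by rewrite -natrX ler_nat ltnW // ltn_expl.
  have [le1 /andP[xl lx] /andP[ym my] /andP[x0x xa] /andP[y0y yb]] := P n.
  set u := a / 2 ^+ n in lx xa Hn *; set v := b / 2 ^+ n in my yb Hn *.
  have u0 : 0 <= u by rewrite divr_ge0 // exprn_ge0.
  have v0 : 0 <= v by rewrite divr_ge0 // exprn_ge0.
  have close s t : x n <= s <= x n + u -> y n <= t <= y n + v ->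
     cmod (f (s +i t) - (f (l +i m) + d * (s +i t - (l +i m)))) <= e * (u + v).
    move=> /andP[s1 s2] /andP[t1 t2].
    have dist : cmod (s +i t - (l +i m)) <= u + v.
      have -> : s +i t - (l +i m) = ofR (s - l) + iC R * ofR (t - m).
        by rewrite !ofRB; ring.
      apply: le_trans (cmodD _ _) _; rewrite cmodM cmodi mul1r !cmodofR.
      by rewrite lerD // ler_norml; apply/andP; split; lra.
    rewrite opprD addrA; apply: le_trans (Hr _ _) _.
      by apply: le_lt_trans dist _; rewrite /u /v -mulrDl.
    by rewrite ler_wpM2l // ltW.
  pose aff p q (s : R) : C := p * ofR s + q * (ofR (s ^+ 2 / 2)).
  have Hrow t : y n <= t <= y n + v ->
     cmod ((H t (x n + u) - H t (x n)) -
       (aff (f (l +i m) + d * (iC R * ofR t - (l +i m))) d (x n + u)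
       - aff (f (l +i m) + d * (iC R * ofR t - (l +i m))) d (x n)))
     <= 2 * (e * (u + v)) * u.
    move=> tI; rewrite (_ : _ * u = 2 * (e * (u + v)) * ((x n + u) - x n)); last by ring.
    apply: (increment_close (pH t) (@antiderivative_affine R a0 _ _)).
    - exact: lt_le_trans x0x.
    - by rewrite lerDl.
    move=> s sI.
    have -> : f (l +i m) + d * (iC R * ofR t - (l +i m)) + d * ofR s
      = f (l +i m) + d * (s +i t - (l +i m)) by ring.
    exact: close.
  have Hcol s : x n <= s <= x n + u ->
     cmod ((V s (y n + v) - V s (y n)) -
       (aff (f (l +i m) + d * (ofR s - (l +i m))) (d * iC R) (y n + v)
       - aff (f (l +i m) + d * (ofR s - (l +i m))) (d * iC R) (y n)))
     <= 2 * (e * (u + v)) * v.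
    move=> sI; rewrite (_ : _ * v = 2 * (e * (u + v)) * ((y n + v) - y n)); last by ring.
    apply: (increment_close (pV s) (@antiderivative_affine R b0 _ _)).
    - exact: lt_le_trans y0y.
    - by rewrite lerDl.
    move=> t tI.
    have -> : f (l +i m) + d * (ofR s - (l +i m)) + d * iC R * ofR t
      = f (l +i m) + d * (s +i t - (l +i m)) by ring.
    exact: close.
  have y1I : y n <= y n <= y n + v by rewrite lexx lerDl.
  have y2I : y n <= y n + v <= y n + v by rewrite lexx lerDl v0.
  have x1I : x n <= x n <= x n + u by rewrite lexx lerDl.
  have x2I : x n <= x n + u <= x n + u by rewrite lexx lerDl u0.
  have bound : I (x n) (y n) n <= 4 * e * (u + v) ^+ 2.
    rewrite /I -/u -/v.
    move: (Hrow _ y1I) (Hrow _ y2I) (Hcol _ x1I) (Hcol _ x2I).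
    rewrite /oint.
    set A1 := H (y n) _ - _; set A2 := H (y n + v) _ - _.
    set B1 := V (x n) _ - _; set B2 := V (x n + u) _ - _.
    set E1 := aff _ _ _ - _; set E2 := aff _ _ _ - _.
    set F1 := aff _ _ _ - _; set F2 := aff _ _ _ - _.
    move=> h1 h2 h3 h4.
    (* The contour integral of an affine function vanishes. *)
    have E0 : E1 + iC R * F2 - (E2 + iC R * F1) = 0.
      rewrite /E1 /E2 /F1 /F2 /aff !(ofRD, ofRM, ofRB, exprD, expr2) !ofRV.
      have := iC2 R; move: (iC R) => i i2.
      have two : ofR (2 : R) = (2 : C) by rewrite -[2]/(1 + 1) ofRD.
      by rewrite two; ring: i2.
    have -> : A1 + iC R * B2 - (A2 + iC R * B1) =
       (A1 - E1) - (A2 - E2) + iC R * ((B2 - F2) - (B1 - F1)).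
      by rewrite -[LHS]subr0 -E0; ring.
    apply: le_trans (cmodD _ _) _; rewrite cmodM cmodi mul1r.
    have := cmodB (A1 - E1) (A2 - E2); have := cmodB (B2 - F2) (B1 - F1).
    move=> g1 g2.
    have -> : 4 * e * (u + v) ^+ 2 = 2 * (e * (u + v)) * u + 2 * (e * (u + v)) * u
      + (2 * (e * (u + v)) * v + 2 * (e * (u + v)) * v) by ring.
    by lra.
  have -> : cmod (oint x0 y0 a b) = I x0 y0 0 by rewrite /I expr0 !divr1.
  apply: le_trans le1 _.
  have -> : 4 * e * (a + b) ^+ 2 = 4 ^+ n * (4 * e * (u + v) ^+ 2).
    rewrite /u /v -mulrDl.
    have -> : (4 : R) ^+ n = (2 ^+ n) ^+ 2 by rewrite -exprM mulnC exprM; congr (_ ^+ n); ring.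
    have h0 : (2 : R) ^+ n != 0 by rewrite expf_neq0.
    by field.
  by rewrite ler_wpM2l // exprn_ge0.
apply/eqP/le_anti; rewrite cmod_ge0 andbT.
apply/ler_addgt0Pr => e e0; rewrite add0r.
have c0 : 0 < 4 * (a + b) ^+ 2 + 1 by rewrite ltr_wpDl // mulr_ge0 // sqr_ge0.
apply: le_trans (key (e / (4 * (a + b) ^+ 2 + 1)) _) _; first by rewrite divr_gt0.
have -> : 4 * (e / (4 * (a + b) ^+ 2 + 1)) * (a + b) ^+ 2
  = e * ((4 * (a + b) ^+ 2) / (4 * (a + b) ^+ 2 + 1)).
  by move: c0; set w := _ + 1 => c0; field; rewrite gt_eqF.
by rewrite ler_piMr ?ltW // ltr_pdivrMr // mul1r ltrDl.
Qed.

End Goursat.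

(** * Functions on the Riemann sphere are constant *)

Section Liouville.
Variable R : realType.
Notation C := (Cplx R).

Lemma epsilon_differentiable (f : C -> C) (p d : C) :
  (forall e : R, 0 < e -> exists2 r : R, 0 < r &
    forall w, cmod w < r -> cmod (f (w + p) - f p - d * w) <= e * cmod w) ->
  differentiable f p.
Proof.
move=> H; apply/derivable1_diffP; apply/cvg_ex; exists d.
apply/cvg_cmodP => e e0; have [r r0 Hr] := H (e / 2) (divr_gt0 e0 (ltr0n _ 2)).
rewrite near_withinE; apply/near_cmodP; exists r => // w; rewrite subr0 => wr w0.
have nw : 0 < cmod w by rewrite lt_neqAle eq_sym cmod_eq0 w0 cmod_ge0.
rewrite -(ltr_pM2r nw) -cmodM /= -[_ *: 1]/(_ * _) mulr1.
rewrite -[_^-1 *: _]/(_ * _) mulrBl mulrAC mulVf // mul1r.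
apply: le_lt_trans (Hr _ wr) _; rewrite ltr_pM2r //.
by rewrite ltr_pdivrMr // mulr2n mulrDr mulr1 ltrDl.
Qed.

Lemma is_derive_epsilon (f : R -> R) (p d : R) : is_derive p 1 f d ->
  forall e : R, 0 < e -> exists2 r : R, 0 < r &
    forall w, `|w| < r -> `|f (w + p) - f p - d * w| <= e * `|w|.
Proof.
move=> [df dE] e e0.
have /cvgrPdist_le : (fun h => h^-1 *: ((f \o shift p) (h *: 1) - f p)) @ 0^' --> d.
  by rewrite -dE; exact: df.
move=> /(_ e e0); rewrite near_withinE => /nbhs_ballP [r /= r0 H].
exists r => // w wr; have [->|w0] := eqVneq w 0.
  by rewrite add0r subrr mulr0 subr0 normr0 mulr0.
have := H w; rewrite /ball /= sub0r normrN => /(_ wr w0).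
rewrite -[_ *: 1]/(_ * _) mulr1 -[_^-1 *: _]/(_ * _) => le.
have nw : 0 < `|w| by rewrite normr_gt0.
have -> : f (w + p) - f p - d * w = - ((d - w^-1 * (f (w + p) - f p)) * w).
  by field.
by rewrite normrN normrM ler_wpM2r.
Qed.

(** Only complex differentiability and the modulus of the exponential matter here; both follow
from the real functions. *)
Definition cexp (z : C) : C :=
  ofR (expR (rePart z)) * (ofR (cos (imPart z)) + iC R * ofR (sin (imPart z))).

Lemma cexpD z w : cexp (z + w) = cexp z * cexp w.
Proof.
rewrite /cexp ReD ImD expRD cosD sinD !(ofRM, ofRB, ofRD).
by have := iC2 R; move: (iC R) => i i2; ring: i2.
Qed.

Lemma cmod_cexp z : cmod (cexp z) = expR (rePart z).
Proof.
rewrite /cexp cmodM cmodofR ger0_norm ?expR_ge0 // cmod_sqrt.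
rewrite !(ReD, ImD, ReM, ImM) ?(ReofR, ImofR, Re_iC, Im_iC).
rewrite !(mul0r, mulr0, mul1r, subr0, addr0, add0r) cos2Dsin2 sqrtr1 mulr1 //.
Qed.

(** The derivative of [cexp] at 0 is 1; by [cexpD] this gives the derivative everywhere. *)
Lemma cexp_epsilon0 (e : R) : 0 < e -> exists2 r : R, 0 < r &
  forall w, cmod w < r -> cmod (cexp w - 1 - w) <= e * cmod w.
Proof.
move=> e0.
have dE : is_derive (0 : R) 1 expR 1 by apply: is_derive_eq (is_derive_expR 0) _; rewrite expR0.
have dC : is_derive (0 : R) 1 cos 0 by apply: is_derive_eq (is_derive_cos 0) _;
  rewrite sin0 oppr0.
have dS : is_derive (0 : R) 1 sin 1 by apply: is_derive_eq (is_derive_sin 0) _; rewrite cos0.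
have [m [m0 m1 m8]] : exists m : R, [/\ 0 < m, m <= 1 & m <= e / 8].
  exists (Num.min 1 (e / 8)); rewrite lt_min ltr01 divr_gt0 //.
  by rewrite !ge_min !lexx orbT.
have [r1 r10 H1] := is_derive_epsilon dE m0.
have [r2 r20 H2] := is_derive_epsilon dC m0.
have [r3 r30 H3] := is_derive_epsilon dS m0.
exists (Num.min (Num.min r1 r2) (Num.min r3 m)); first by rewrite !lt_min r10 r20 r30 m0.
move=> w; rewrite !lt_min => /andP[/andP[w1 w2] /andP[w3 wm]].
have X := Re_le_cmod w; have Y := Im_le_cmod w.
have := H1 (rePart w) (le_lt_trans X w1); rewrite addr0 expR0 mul1r.
have := H2 (imPart w) (le_lt_trans Y w2); rewrite addr0 cos0 mul0r subr0.
have := H3 (imPart w) (le_lt_trans Y w3); rewrite addr0 sin0 mul1r subr0.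
have C1 : `|cos (imPart w)| <= 1 by rewrite ler_norml cos_geN1 cos_le1.
move: C1 X Y; rewrite /cexp.
set x := rePart w; set y := imPart w; set n := cmod w in wm *.
move=> C1 X Y hs hc he.
have n0 : 0 <= n by exact: cmod_ge0.
set Ex := expR x in he *; set cy := cos y in C1 hc *; set sy := sin y in hs *.
have he' : `|Ex - 1 - x| <= m * n by apply: le_trans he _; rewrite ler_pM2l.
have hc' : `|cy - 1| <= m * n by apply: le_trans hc _; rewrite ler_pM2l.
have hs' : `|sy - y| <= m * n by apply: le_trans hs _; rewrite ler_pM2l.
have x1 : `|1 + x| <= 2.
  apply: le_trans (ler_normD _ _) _; rewrite normr1.
  have : n <= 1 by apply: le_trans (ltW wm) _.
  by move=> ?; lra.
have Em : `|Ex - 1| <= 2 * m.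
  have -> : Ex - 1 = (Ex - 1 - x) + x by ring.
  apply: le_trans (ler_normD _ _) _.
  have : m * n <= m by rewrite ler_piMr ?ltW // (lt_le_trans wm).
  by move: X he' (ltW wm) => ????; lra.
have sn : `|sy| <= 2 * n.
  have -> : sy = (sy - y) + y by ring.
  apply: le_trans (ler_normD _ _) _.
  have : m * n <= n by rewrite ler_piMl.
  by move=> ?; lra.
apply: le_trans (cmod_leReIm _) _.
rewrite !(ReD, ImD, ReN, ImN, ReM, ImM) ?(ReofR, ImofR, Re_iC, Im_iC) -/x -/y.
have -> : Ex * (cy + (0 * sy - 1 * 0)) - 0 * (0 + (0 * 0 + 1 * sy)) - 1 - x =
  (Ex - 1 - x) * cy + (1 + x) * (cy - 1) by ring.
have -> : Ex * (0 + (0 * 0 + 1 * sy)) + 0 * (cy + (0 * sy - 1 * 0)) - 0 - y =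
  (Ex - 1) * sy + (sy - y) by ring.
have b1 : `|(Ex - 1 - x) * cy| <= m * n.
  by rewrite normrM -[leRHS]mulr1 ler_pM.
have b2 : `|(1 + x) * (cy - 1)| <= 2 * (m * n) by rewrite normrM ler_pM.
have b3 : `|(Ex - 1) * sy| <= 2 * m * (2 * n) by rewrite normrM ler_pM.
have b4 : m * n <= e / 8 * n by rewrite ler_wpM2r.
have := ler_normD ((Ex - 1 - x) * cy) ((1 + x) * (cy - 1)).
have := ler_normD ((Ex - 1) * sy) (sy - y).
move=> ??; lra.
Qed.

Lemma cexp_differentiable z : differentiable cexp z.
Proof.
apply: (@epsilon_differentiable _ _ (cexp z)) => e e0.
have n0 : 0 < cmod (cexp z) by rewrite cmod_cexp expR_gt0.
have [r r0 H] := cexp_epsilon0 (divr_gt0 e0 n0).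
exists r => // w /H wr; rewrite cexpD.
have -> : cexp w * cexp z - cexp z - cexp z * w = cexp z * (cexp w - 1 - w) by ring.
rewrite cmodM mulrC -ler_pdivlMr //.
by rewrite mulrAC.
Qed.

(** The function h = f o exp has period 2 pi i, so that the horizontal sides of the rectangle
[-L, L] x [0, 2 pi] contribute equally to Goursat's identity. What remains equates the integrals
of h over the vertical sides, which are close to 2 pi (f 0) and 2 pi l when L is large. *)
Lemma value_at_0_eq_limit (f : C -> C) (l : C) :
  (forall z, differentiable f z) ->
  (forall e : R, 0 < e -> exists r : R, forall z, r < cmod z -> cmod (f z - l) <= e) ->
  f 0 = l.
Proof.
move=> df lim.
pose h := f \o cexp.
have dh z : differentiable h z by apply: differentiable_comp;
  [exact: cexp_differentiable|exact: df].
have key (e : R) : 0 < e -> cmod (f 0 - l) <= 4 * e.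
  move=> e0; have [r Hr] := lim e e0.
  have /near_cmodP [d d0 Hd] : \forall z \near (0 : C), cmod (f z - f 0) < e.
    have /cvg_cmodP := differentiable_continuous (df 0); exact.
  pose L : R := Num.max 1 (Num.max r d^-1).
  have L1 : 1 <= L by rewrite le_max lexx.
  have Lr : r <= L by rewrite !le_max lexx !orbT.
  have Ld : d^-1 <= L by rewrite !le_max lexx !orbT.
  have eL : L < expR L.
    apply: lt_le_trans (expR_ge1Dx L); by rewrite ltrDr.
  have pi0 : (0 : R) < pi by exact: pi_gt0.
  have /choice [H pH] : forall y : R, exists Hy,
      antiderivative (- L - 1) Hy (fun x => h (ofR x + iC R * ofR y)).
    by move=> y; apply: exists_antiderivative; exact: continuous_row.
  have /choice [V pV] : forall x : R, exists Vx,
      antiderivative (- 1) Vx (fun y => h (ofR x + iC R * ofR y)).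
    by move=> x; apply: exists_antiderivative; exact: continuous_column.
  have := @goursat_rectangle R h dh (- L) 0 (2 * L) (2 * pi) (- L - 1) (- 1) H V.
  move=> /(_ _ _ _ _ pH pV).
  have -> : - L + 2 * L = L by ring.
  rewrite add0r => G.
  have {}G := G ltac:(lra) ltac:(lra) ltac:(lra) ltac:(lra).
  (* By periodicity the two horizontal sides have the same integral. *)
  have HE : H (2 * pi) L - H (2 * pi) (- L) = H 0 L - H 0 (- L).
    apply/eqP; rewrite -subr_eq0 -cmod_eq0; apply/eqP/le_anti; rewrite cmod_ge0 andbT.
    apply: le_trans (@increment_close R _ _ _ _ _ (- L) L 0 (pH (2 * pi)) (pH 0) _ _ _) _;
      try lra.
    move=> x _; rewrite /h /= /cexp !ReD !ImD !ReM !ImM !ReofR !ImofR Re_iC Im_iC.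
    rewrite !(mul0r, mulr0, mul1r, subr0, addr0, add0r) cos0 sin0.
    rewrite mulr_natl cos2pi.
    by rewrite [sin _](_ : _ = 0) ?subrr ?cmod0 // mulr2n sinD sinpi mulr0 mul0r addr0.
  move: G; rewrite HE => /addrI /(mulfI _).
  have i0 : iC R != 0 by rewrite -cmod_eq0 cmodi oner_eq0.
  move=> /(_ i0) G.
  (* A vertical side where h is e-close to c has integral close to 2 pi c. *)
  have side (x : R) (c : C) : (forall y : R, cmod (h (ofR x + iC R * ofR y) - c) <= e) ->
      cmod ((V x (2 * pi) - V x 0) - c * ofR (2 * pi)) <= 2 * e * (2 * pi).
    move=> Hx; rewrite -[X in _ <= _ * X]subr0.
    have -> : c * ofR (2 * pi) = (c * ofR (2 * pi) + 0 * ofR ((2 * pi) ^+ 2 / 2)) -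
       (c * ofR 0 + 0 * ofR (0 ^+ 2 / 2)) by rewrite ofR0; ring.
    apply: (increment_close (pV x) (@antiderivative_affine R (- 1) c 0)); try lra.
    by move=> y _; rewrite mul0r addr0.
  have rec (x y : R) : cmod (cexp (ofR x + iC R * ofR y)) = expR x.
    by rewrite cmod_cexp ReD ReM !ReofR ImofR Re_iC mul0r mulr0 subr0 addr0.
  have S1 : cmod ((V L (2 * pi) - V L 0) - l * ofR (2 * pi)) <= 2 * e * (2 * pi).
    apply: side => y; apply: Hr; rewrite rec; exact: le_lt_trans eL.
  have S2 : cmod ((V (- L) (2 * pi) - V (- L) 0) - f 0 * ofR (2 * pi)) <= 2 * e * (2 * pi).
    apply: side => y; apply/ltW/Hd; rewrite subr0 rec expRN -[d]invrK.
    by rewrite ltf_pV2 ?posrE ?expR_gt0 ?invr_gt0 //; exact: le_lt_trans eL.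
  rewrite G in S1.
  have : cmod ((f 0 - l) * ofR (2 * pi)) <= 2 * (2 * e * (2 * pi)).
    move: S1 S2; set D := V _ _ - _; move=> S1 S2.
    have -> : (f 0 - l) * ofR (2 * pi) = (D - l * ofR (2 * pi)) - (D - f 0 * ofR (2 * pi)) by
      ring.
    by apply: le_trans (cmodB _ _) _; lra.
  have pp : 0 < 2 * pi :> R by rewrite mulr_gt0.
  rewrite cmodM cmodofR (ger0_norm (ltW pp)) => le.
  by rewrite -(ler_pM2r pp); apply: le_trans le _; rewrite le_eqVlt; apply/orP; left; apply/eqP;
    ring.
apply/eqP; rewrite -subr_eq0 -cmod_eq0; apply/eqP/le_anti; rewrite cmod_ge0 andbT.
apply/ler_addgt0Pr => e e0; rewrite add0r.
apply: le_trans (key (e / 4) _) _; first by rewrite divr_gt0.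
by lra.
Qed.

(** The pair (a, b) is a function on the Riemann sphere. Every translate of a is entire with
limit b 0 at infinity. *)
Theorem sphere_function_constant (a b : C -> C) :
  (forall z, differentiable a z) -> (forall z, differentiable b z) ->
  (forall z, z != 0 -> a z = b z^-1) -> forall w, a w = b 0.
Proof.
move=> da db ab w.
have <- : (fun z => a (z + w)) 0 = a w by rewrite add0r.
apply: (@value_at_0_eq_limit (fun z => a (z + w))).
  move=> z; apply: (@differentiable_comp _ _ _ _ (fun z => z + w) a) => //.
move=> e e0.
have /near_cmodP [d d0 Hd] : \forall z \near (0 : C), cmod (b z - b 0) < e.
  have /cvg_cmodP := differentiable_continuous (db 0); exact.
exists (cmod w + d^-1) => z zw.
have : d^-1 < cmod (z + w).
  have := cmodB (z + w) w; rewrite addrK; lra.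
move=> zw'; have z0 : 0 < cmod (z + w) by apply: lt_trans zw'; rewrite invr_gt0.
have zw0 : z + w != 0 by rewrite -cmod_eq0 gt_eqF.
rewrite ab //; apply/ltW/Hd; rewrite subr0.
have -> : cmod (z + w)^-1 = (cmod (z + w))^-1.
  by apply: (mulIf (lt0r_neq0 z0)); rewrite -cmodM !mulVf ?cmod1 // gt_eqF.
by rewrite -[d]invrK ltf_pV2 ?posrE ?invr_gt0.
Qed.
End Liouville.

(** * Calculus of maps of class C^n *)

Section Smooth.
Variable R : realType.
Notation C := (Cplx R).

Lemma scale_mulC (c z : C) : c *: z = c * z. Proof. by []. Qed.

(** The relational form of [real_derive], convenient to compute limits. *)
Definition has_real_derive (E F : normedModType C) (f : E -> F) (x v : E) (l : F) : Prop :=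
  real_quotient f x v h @[h --> (0 : R)^'] --> l.

Lemma has_real_derive_val (E F : normedModType C) (f : E -> F) x v l :
  has_real_derive f x v l -> real_derive f x v = l.
Proof. by move=> H; apply: cvg_lim; [exact: norm_hausdorff|exact: H]. Qed.

Lemma has_real_derive_derivable (E F : normedModType C) (f : E -> F) x v l :
  has_real_derive f x v l -> real_derivable f x v.
Proof. by move=> H; apply/cvg_ex; exists l. Qed.

Lemma real_derivable_has_derive (E F : normedModType C) (f : E -> F) x v :
  real_derivable f x v -> has_real_derive f x v (real_derive f x v).
Proof. by []. Qed.

Lemma real_line_cvg (E : normedModType C) (x v : E) :
  x + (ofR h : C) *: v @[h --> (0 : R)^'] --> x.
Proof.
rewrite -[X in _ --> X]addr0; apply: cvgD; first exact: cvg_cst.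
rewrite -(scale0r v); apply: cvgZr_tmp.
apply: cvg_trans (@ofR_continuous R 0).
by apply: cvg_app; exact: cvg_within.
Qed.

Lemma has_real_derive_ext (E F : normedModType C) (U : set E) (f g : E -> F) x v l :
  open U -> U x -> (forall y, U y -> f y = g y) -> has_real_derive f x v l -> has_real_derive g x
    v l.
Proof.
move=> oU Ux fg; apply: cvg_trans; apply: near_eq_cvg.
have : \forall h \near (0 : R)^', U (x + (ofR h : C) *: v).
  by apply: (@real_line_cvg E x v); apply: open_nbhs_nbhs.
by apply: filterS => h Uh; rewrite /real_quotient !fg.
Qed.

Lemma Cn_continuous n (E F : normedModType C) (U : set E) (f : E -> F) :
  Cn_on n U f -> forall x, U x -> {for x, continuous f}.
Proof. by case: n => [|n] []. Qed.

Lemma open_setXT (E E' : normedModType C) (U : set E) : open U -> open (U `*` [set: E']).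
Proof.
move=> oU; have -> : U `*` [set: E'] = fst @^-1` U by apply/seteqP; split=> [] p //= [].
by apply: open_comp => // p _; exact: cvg_fst.
Qed.

Lemma Cn_ext n (E F : normedModType C) (U : set E) (f g : E -> F) :
  open U -> (forall y, U y -> f y = g y) -> Cn_on n U f -> Cn_on n U g.
Proof.
elim: n E F U f g => [|n IH] E F U f g oU fg H.
all: split; first (move=> x Ux; have := Cn_continuous H Ux;
  rewrite /prop_for /continuous_at (fg x Ux);
    apply: cvg_trans; apply: near_eq_cvg;
    by apply: filterS (open_nbhs_nbhs (conj oU Ux)) => y Uy; rewrite fg).
  by [].
case: H => _ [D H]; split=> [x v Ux|].
  exact: (has_real_derive_derivable (has_real_derive_ext oU Ux fg (real_derivable_has_derive (D x
    v Ux)))).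
apply: IH H; first exact: open_setXT.
move=> [x v] [/= Ux _].
by apply/esym/has_real_derive_val/(has_real_derive_ext oU Ux fg)/real_derivable_has_derive/D.
Qed.

Lemma Cn_sub n (E F : normedModType C) (U V : set E) (f : E -> F) :
  V `<=` U -> Cn_on n U f -> Cn_on n V f.
Proof.
elim: n E F U V f => [|n IH] E F U V f VU [c H].
  by split=> // x /VU; exact: c.
case: H => [D H]; split; first by move=> x /VU; exact: c.
split; first by move=> x v /VU; exact: D.
by apply: IH H => p [/= /VU].
Qed.

Lemma Cn_down n (E F : normedModType C) (U : set E) (f : E -> F) :
  Cn_on n.+1 U f -> Cn_on n U f.
Proof.
elim: n E F U f => [|n IH] E F U f [c [D H]]; split=> //.
by split=> //; apply: IH.
Qed.

(** Complex conjugation is a smooth map that is not complex linear, hence linearity over the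
reals only. *)
Definition real_linear (E F : normedModType C) (L : E -> F) : Prop :=
  [/\ continuous L, forall x y, L (x + y) = L x + L y &
      forall (h : R) x, L ((ofR h : C) *: x) = (ofR h : C) *: L x].

Lemma real_linearB (E F : normedModType C) (L : E -> F) : real_linear L -> forall x y,
  L (x - y) = L x - L y.
Proof.
case=> _ D Z x y; rewrite D; congr (_ + _).
by have := Z (-1) y; rewrite ofRN ofR1 !scaleN1r.
Qed.

Lemma real_linear_fst (E F : normedModType C) : real_linear (@fst E F).
Proof. by split=> // x; exact: cvg_fst. Qed.

Lemma real_linear_snd (E F : normedModType C) : real_linear (@snd E F).
Proof. by split=> // x; exact: cvg_snd. Qed.

Lemma real_linear_comp (E F G : normedModType C) (L : F -> G) (M : E -> F) :
  real_linear L -> real_linear M -> real_linear (L \o M).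
Proof.
move=> [cL aL zL] [cM aM zM]; split=> [|x y|h x] /=.
- by move=> x; apply: continuous_comp; [exact: cM|exact: cL].
- by rewrite aM aL.
- by rewrite zM zL.
Qed.

Lemma real_linear_prod (E F E' F' : normedModType C) (L : E -> F) (M : E' -> F') :
  real_linear L -> real_linear M -> real_linear (fun p : E * E' => (L p.1, M p.2) : F * F').
Proof.
move=> [cL aL zL] [cM aM zM]; split=> [|x y|h x] /=.
- move=> x; apply: cvg_pair => /=.
  + by apply: (@continuous_comp _ _ _ fst L); [exact: cvg_fst|exact: cL].
  + by apply: (@continuous_comp _ _ _ snd M); [exact: cvg_snd|exact: cM].
- by rewrite aM aL.
- by rewrite zM zL.
Qed.

(** Precomposition with a real linear L commutes with directional derivatives exactly: the
difference quotients are equal before any limit is taken. It serves to read a function of x as a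
function of (x, v). *)
Lemma Cn_precomp n (E E' F : normedModType C) (L : E -> E') (U : set E') (f : E' -> F) :
  real_linear L -> Cn_on n U f -> Cn_on n (L @^-1` U) (f \o L).
Proof.
elim: n E E' F L U f => [|n IH] E E' F L U f lL H.
all: have cL : continuous L by case: lL.
all: split; first (by move=> x Ux; apply: continuous_comp; [exact: cL|exact: (Cn_continuous H)]).
  by [].
have q x v : real_quotient (f \o L) x v = real_quotient f (L x) (L v).
  by case: lL => _ D Z; apply/funext => h; rewrite /real_quotient /= D Z.
case: H => _ [D H]; split=> [x v Ux|].
  by rewrite /real_derivable q; exact: D.
have := IH _ _ _ _ _ _ (real_linear_prod lL lL) H.
by congr Cn_on; apply/funext => p; rewrite /real_derive q.
Qed.

Lemma Cn_postcomp n (E F F' : normedModType C) (L : F -> F') (U : set E) (f : E -> F) :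
  open U -> real_linear L -> Cn_on n U f -> Cn_on n U (L \o f).
Proof.
elim: n E F F' L U f => [|n IH] E F F' L U f oU lL H.
all: have cL : continuous L by case: lL.
all: split; first (by move=> x Ux; apply: continuous_comp; [exact: (Cn_continuous H)|exact: cL]).
  by [].
case: H => _ [D H].
have key x v : U x -> has_real_derive (L \o f) x v (L (real_derive f x v)).
  move=> Ux; have := real_derivable_has_derive (D x v Ux).
  rewrite {2}/has_real_derive; have -> : real_quotient (L \o f) x v = L \o real_quotient f x v.
    apply/funext => h.
    rewrite /real_quotient /= -(real_linearB lL); case: lL => _ _ Z.
    by rewrite -[X in X *: _]/((ofR h)^-1) -ofRV Z.
  by move=> h; apply: cvg_comp h _; exact: cL.
split=> [x v Ux|]; first exact: (has_real_derive_derivable (key x v Ux)).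
apply: Cn_ext (IH _ _ _ L _ _ _ lL H); try exact: open_setXT.
by move=> [x v] [/= Ux _]; apply/esym/has_real_derive_val/key.
Qed.

Lemma Cn_cst n (E F : normedModType C) (U : set E) (c : F) : open U -> Cn_on n U (fun=> c).
Proof.
elim: n E F U c => [|n IH] E F U c oU.
all: split; first (by move=> x _; exact: cvg_cst).
  by [].
have key (x v : E) : has_real_derive (fun=> c) x v 0.
  rewrite /has_real_derive; have -> : real_quotient (fun=> c) x v = fun=> 0.
    by apply/funext => h; rewrite /real_quotient subrr scaler0.
  exact: cvg_cst.
split=> [x v _|]; first exact: has_real_derive_derivable (key x v).
apply: Cn_ext (IH _ _ _ 0 _); try exact: open_setXT.
by move=> [x v] _; apply/esym/has_real_derive_val/key.
Qed.

Lemma Cn_rlin n (E F : normedModType C) (U : set E) (L : E -> F) :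
  open U -> real_linear L -> Cn_on n U L.
Proof.
elim: n E F U L => [|n IH] E F U L oU lL.
all: have cL : continuous L by case: lL.
all: split; first (by move=> x _; exact: cL).
  by [].
have key (x v : E) : has_real_derive L x v (L v).
  apply: (@cvg_trans _ (L v @[h --> (0 : R)^'])); last exact: cvg_cst.
  apply: near_eq_cvg; rewrite near_withinE; apply: nearW => h h0.
  rewrite /real_quotient; case: lL => _ D Z; rewrite D Z addrAC subrr add0r.
  by rewrite scalerA mulVf ?scale1r // (ofR_eq0 h).
split=> [x v _|]; first exact: has_real_derive_derivable (key x v).
apply: Cn_ext (IH _ _ _ (L \o snd) _ _); try exact: open_setXT.
  by move=> [x v] _; apply/esym/has_real_derive_val/key.
exact: real_linear_comp lL (real_linear_snd _ _).
Qed.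

Lemma CnD n (E F : normedModType C) (U : set E) (f g : E -> F) :
  open U -> Cn_on n U f -> Cn_on n U g -> Cn_on n U (fun x => f x + g x).
Proof.
elim: n E F U f g => [|n IH] E F U f g oU Hf Hg.
all: split; first (by move=> x Ux; apply: cvgD; [exact: (Cn_continuous Hf)|exact: (Cn_continuous
  Hg)]).
  by [].
case: Hf => _ [Df Hf]; case: Hg => _ [Dg Hg].
have key x v : U x -> has_real_derive (fun x => f x + g x) x v (real_derive f x v + real_derive g
  x v).
  move=> Ux.
  rewrite /has_real_derive; have -> : real_quotient (fun x => f x + g x) x v =
      (fun h => real_quotient f x v h + real_quotient g x v h).
    apply/funext => h.
    by rewrite /real_quotient -scalerDr opprD addrACA.
  by apply: cvgD; apply: real_derivable_has_derive; auto.
split=> [x v Ux|]; first exact: (has_real_derive_derivable (key x v Ux)).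
apply: Cn_ext (IH _ _ _ _ _ _ Hf Hg); try exact: open_setXT.
by move=> [x v] [/= Ux _]; apply/esym/has_real_derive_val/key.
Qed.

Lemma Cn_fst n (E E' F : normedModType C) (U : set E) (f : E -> F) :
  Cn_on n U f -> Cn_on n (U `*` [set: E']) (fun p => f p.1).
Proof.
move=> H; have := Cn_precomp (real_linear_fst E E') H; congr Cn_on.
by apply/seteqP; split=> [] p //= [].
Qed.

(** By the Leibniz rule the derivative is a sum of products of maps that are C^n by induction.
[Cn_fst] turns f and g into functions of (x, v). *)
Lemma CnM n (E : normedModType C) (U : set E) (f g : E -> C) :
  open U -> Cn_on n U f -> Cn_on n U g -> Cn_on n U (fun x => f x * g x).
Proof.
elim: n E U f g => [|n IH] E U f g oU Hf Hg.
all: split; first (by move=> x Ux; apply: cvgM; [exact: (Cn_continuous Hf)|exact: (Cn_continuous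
  Hg)]).
  by [].
have Hf' := Cn_down Hf; have Hg' := Cn_down Hg; have cg := Cn_continuous Hg.
case: Hf => _ [Df Hf]; case: Hg => _ [Dg Hg].
have key x v : U x -> has_real_derive (fun x => f x * g x) x v
    (real_derive f x v * g x + f x * real_derive g x v).
  move=> Ux.
  rewrite /has_real_derive; have -> : real_quotient (fun x => f x * g x) x v =
      (fun h => real_quotient f x v h * g (x + (ofR h : C) *: v) + f x * real_quotient g x v h).
    apply/funext => h.
    rewrite /real_quotient !scale_mulC -[real_complex R h]/(ofR h).
    set c := _^-1; set y := x + _; ring.
  apply: cvgD; apply: cvgM; try exact: cvg_cst; try by apply: real_derivable_has_derive; auto.
  by apply: cvg_comp (@real_line_cvg E x v) _; exact: cg.
split=> [x v Ux|]; first exact: (has_real_derive_derivable (key x v Ux)).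
have oV := open_setXT (E' := E) oU.
apply: Cn_ext (CnD oV (IH _ _ _ _ oV Hf (Cn_fst E Hg')) (IH _ _ _ _ oV (Cn_fst E Hf') Hg)) => //.
by move=> [x v] [/= Ux _]; exact: (esym (has_real_derive_val (key x v Ux))).
Qed.

Lemma CnN n (E F : normedModType C) (U : set E) (f : E -> F) :
  open U -> Cn_on n U f -> Cn_on n U (fun x => - f x).
Proof.
move=> oU H; apply: (Cn_postcomp (L := fun y : F => - y)) => //.
split=> [x|x y|h x]; [exact: cvgN (@cvg_id _ _)|exact: opprD|by rewrite scalerN].
Qed.

(** The derivative of 1/f is - df (1/f)^2, where 1/f is C^n by induction. *)
Lemma CnV n (E : normedModType C) (U : set E) (f : E -> C) :
  open U -> (forall x, U x -> f x != 0) -> Cn_on n U f -> Cn_on n U (fun x => (f x)^-1).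
Proof.
move=> oU f0; elim: n => [|n IH] H.
all: have ci : forall x, U x -> {for x, continuous (fun x => (f x)^-1)}
  by move=> x Ux; apply: cvgV; [exact: f0|exact: (Cn_continuous H)].
all: split=> //.
have {}IH := IH (Cn_down H).
case: H => _ [D H].
have key x v : U x -> has_real_derive (fun x => (f x)^-1) x v
    (- (real_derive f x v * ((f x)^-1 * (f x)^-1))).
  move=> Ux.
  have nz : \forall h \near (0 : R)^', U (x + (ofR h : C) *: v).
    by apply: (@real_line_cvg E x v); apply: open_nbhs_nbhs.
  apply: (@cvg_trans _ ((- (real_quotient f x v h * ((f (x + (ofR h : C) *: v))^-1 * (f x)^-1)))
       @[h --> (0 : R)^'])).
    apply: near_eq_cvg; apply: filterS nz => h Uh.
    rewrite /real_quotient !scale_mulC -[real_complex R h]/(ofR h).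
    have := f0 _ Uh; have := f0 _ Ux; set c := _^-1; set y := x + _ => a b.
    by field; rewrite a b.
  apply: cvgN; apply: cvgM; first exact: real_derivable_has_derive (D x v Ux).
  apply: cvgM; last exact: cvg_cst.
  have Z : (f y)^-1 @[y --> x] --> (f x)^-1 := ci x Ux.
  exact: (@cvg_comp _ _ _ (fun h : R => x + (ofR h : C) *: v) (fun y => (f y)^-1) _ _ _
    (@real_line_cvg E x v) Z).
split=> [x v Ux|]; first exact: (has_real_derive_derivable (key x v Ux)).
have oV := open_setXT (E' := E) oU.
apply: Cn_ext (CnN oV (CnM oV H (CnM oV (Cn_fst E IH) (Cn_fst E IH)))) => //.
by move=> [x v] [/= Ux _]; exact: (esym (has_real_derive_val (key x v Ux))).
Qed.

Lemma Cn_pair n (E F F' : normedModType C) (U : set E) (f : E -> F) (g : E -> F') :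
  open U -> Cn_on n U f -> Cn_on n U g -> Cn_on n U (fun x => (f x, g x)).
Proof.
move=> oU Hf Hg.
have l1 : real_linear (fun y : F => (y, 0) : F * F').
  split=> [x|x y|h x].
  - by apply: cvg_pair; [exact: cvg_id|exact: cvg_cst].
  - by congr pair; rewrite /= addr0.
  - by congr pair; rewrite /= scaler0.
have l2 : real_linear (fun y : F' => (0, y) : F * F').
  split=> [x|x y|h x].
  - by apply: cvg_pair; [exact: cvg_cst|exact: cvg_id].
  - by congr pair; rewrite /= addr0.
  - by congr pair; rewrite /= scaler0.
apply: Cn_ext (CnD oU (Cn_postcomp oU l1 Hf) (Cn_postcomp oU l2 Hg)) => //.
by move=> x _; congr pair; rewrite /= ?addr0 ?add0r.
Qed.

End Smooth.

(** * Manifolds glued from two charts *)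

Lemma near_diff (R : realType) (E1 E2 : normedModType (Cplx R)) (f g : E1 -> E2) x :
  (\forall y \near x, f y = g y) -> differentiable f x ->
  differentiable g x /\ 'd g x = 'd f x :> (E1 -> E2).
Proof.
move=> fg df.
have fgx : f x = g x by apply: (nbhs_singleton fg).
have exp : g \o shift x = cst (g x) + 'd f x +o_ 0 id.
  apply/eqaddoP => eps eps0.
  have /eqaddoP /(_ eps eps0) := diff_locally df.
  have : \forall h \near (0 : E1), f (h + x) = g (h + x).
    have sh : (fun h : E1 => h + x) @ 0 --> x.
      by rewrite -[X in _ --> X]add0r; apply: cvgD; [exact: cvg_id|exact: cvg_cst].
    exact: sh _ fg.
  by apply: filterS2 => h; rewrite !fctE /= fgx => ->.
have dg : 'd g x = 'd f x :> (E1 -> E2).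
  exact: diff_unique (diff_continuous df) exp.
split; last exact: dg.
by apply/diff_locallyP; rewrite dg; split; [exact: diff_continuous|exact: exp].
Qed.

Lemma near_differentiable (R : realType) (E1 E2 : normedModType (Cplx R)) (f g : E1 -> E2) x :
  (\forall y \near x, f y = g y) -> differentiable f x -> differentiable g x.
Proof. by move=> fg df; have [] := near_diff fg df. Qed.

Lemma neq_negb (b c : bool) : b != c -> b = ~~ c.
Proof. by case: b; case: c. Qed.

Section Glue.
Variables (R : realType) (E : normedModType (Cplx R)).
Notation C := (Cplx R).
Variables (e : equiv_rel (bool * E)) (tau : bool -> E -> E).

(** The chart number b is a boolean; [tau b] goes from chart b to the other chart and [O b] is
the part of chart b that is glued. The relation e is kept abstract so that the quotient that
defines W_k is an instance up to conversion. *)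
Definition glued_space : topologicalType := quotient_topology {eq_quot e}.

Definition glued_class (p : bool * E) : glued_space := \pi_({eq_quot e}) p.

Definition glued_chart (b : bool) : chart E glued_space :=
  Chart (range (fun x => glued_class (b, x)))
        (fun w => let p := repr (w : {eq_quot e}) in
                  if p.1 == b then p.2 else tau (~~ b) p.2)
        (fun x => glued_class (b, x)).

Definition glued : atlased E := Atlased [set glued_chart true; glued_chart false].

(** [glue_sep] is what the Hausdorff property requires: the graph of the transition map is
closed in the product of the two charts. *)
Record glue_data (O : bool -> set E) : Prop := GlueData {
  glue_rel : forall p q, e p q <->
    p = q \/ [/\ q.1 = ~~ p.1, O p.1 p.2 & q.2 = tau p.1 p.2];
  glue_open : forall b, open (O b);
  glue_dom : forall b x, O b x -> O (~~ b) (tau b x);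
  glueK : forall b x, O b x -> tau (~~ b) (tau b x) = x;
  glue_diff : forall b x, O b x -> differentiable (tau b) x;
  glue_sep : forall x y, ~ (O true x /\ y = tau true x) ->
    exists A B : set E, [/\ nbhs x A, nbhs y B &
      forall a b, A a -> B b -> ~ (O true a /\ b = tau true a)] }.

Variable O : bool -> set E.
Hypothesis G : glue_data O.

Lemma glued_class_surj (w : glued_space) : exists b x, w = glued_class (b, x).
Proof.
exists (repr (w : {eq_quot e})).1, (repr (w : {eq_quot e})).2.
by rewrite /glued_class -surjective_pairing reprK.
Qed.

Lemma glued_classP p q : glued_class p = glued_class q <-> e p q.
Proof. by split=> [|H]; [move/eqmodP|apply/eqmodP]. Qed.

Lemma glued_class_glue b x : O b x -> glued_class (~~ b, tau b x) = glued_class (b, x).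
Proof. by move=> Ox; apply/esym/glued_classP/(glue_rel G); right. Qed.

Lemma glued_class_same b x y : glued_class (b, x) = glued_class (b, y) -> x = y.
Proof. by move=> /glued_classP /(glue_rel G) [[]//|[/=]]; case: b. Qed.

Lemma glued_class_cross b x y : glued_class (b, x) = glued_class (~~ b, y) -> O b x /\ y =
  tau b x.
Proof. by move=> /glued_classP /(glue_rel G) [[]|[/= _ ?]] //; case: b. Qed.

Lemma glued_class_dom b x : chart_dom (glued_chart b) (glued_class (b, x)).
Proof. by exists x. Qed.

Lemma glued_class_domN b x : chart_dom (glued_chart (~~ b)) (glued_class (b, x)) <-> O b x.
Proof.
split=> [[y _ /esym /glued_class_cross []//]|Ox].
by exists (tau b x) => //; exact: glued_class_glue.
Qed.

Lemma glued_chartK b x : glued_chart b (glued_class (b, x)) = x.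
Proof.
rewrite /glued_chart /=; set p := repr _.
have : glued_class p = glued_class (b, x) by rewrite /glued_class reprK.
case: p => c y /=; have [->|cb] := eqVneq c b; first exact: glued_class_same.
have -> := neq_negb cb.
by move=> /esym /glued_class_cross [Ox ->]; rewrite (glueK G).
Qed.

Lemma glued_chartN b x : O b x -> glued_chart (~~ b) (glued_class (b, x)) = tau b x.
Proof. by move=> Ox; rewrite -(glued_class_glue Ox) glued_chartK. Qed.

(** Functions on the glued space are defined by evaluation at a representative; this computes
them on a class of any chart, once they are compatible with the gluing. *)
Lemma glued_liftE T (f : bool -> E -> T) :
  (forall b x, O b x -> f (~~ b) (tau b x) = f b x) ->
  forall b x, (let p := repr (glued_class (b, x) : {eq_quot e}) in f p.1 p.2) = f b x.
Proof.
move=> H b x /=; set p := repr _.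
have : glued_class p = glued_class (b, x) by rewrite /glued_class reprK.
case: p => c y /=; have [->|cb] := eqVneq c b; first by move/glued_class_same ->.
have -> := neq_negb cb.
by move=> /esym /glued_class_cross [Ox ->]; rewrite H.
Qed.

Lemma glued_openP (V : set glued_space) : open V <-> forall b, open [set x | V (glued_class (b,
  x))].
Proof.
split=> [oV b|H].
  have c : continuous (fun x : E => glued_class (b, x)).
    move=> x; apply: (@continuous_comp _ _ _ (fun x : E => (b, x)) glued_class).
      move=> P [[A B] /= [Ab Bx] AB]; apply: filterS Bx => y By; apply: AB.
      by split=> //; exact: (nbhs_singleton Ab).
    exact: pi_continuous.
  by move/continuousP : c; apply.
rewrite /open /= /quotient_open openE => -[b x] Vx.
exists ([set b], [set x | V (glued_class (b, x))]) => /=.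
  by split; [rewrite nbhs_principalE; exact/principal_filterP|apply: open_nbhs_nbhs; split].
by move=> [c y] /= [-> ].
Qed.

Lemma glued_class_open b (U : set E) : open U -> open ((fun x => glued_class (b, x)) @` U).
Proof.
move=> oU; apply/glued_openP => c; have [<-|bc] := eqVneq b c.
  suff -> : [set x | ((fun x => glued_class (b, x)) @` U) (glued_class (b, x))] = U by [].
  by apply/seteqP; split=> [x [y Uy /glued_class_same <-]//|x Ux]; exists x.
have -> := neq_negb bc.
suff -> : [set x | ((fun x => glued_class (~~ c, x)) @` U) (glued_class (c, x))]
     = O c `&` tau c @^-1` U.
  rewrite openE => x [Ox Ux]; apply: filterI.
    by apply: open_nbhs_nbhs; split=> //; exact: (glue_open G).
  have /differentiable_continuous := glue_diff G Ox.
  by apply; apply: open_nbhs_nbhs.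
apply/seteqP; split=> [x [y Uy /esym /glued_class_cross [Ox E1]]|x [Ox Ux]].
  by split=> //=; rewrite -E1.
by exists (tau c x) => //; exact: glued_class_glue.
Qed.

(** The inclusions of the charts are continuous and open, so local questions on the glued space
become questions on E. *)
Lemma glued_nbhsP b x (P : set glued_space) :
  nbhs (glued_class (b, x)) P <-> nbhs x (fun y => P (glued_class (b, y))).
Proof.
split; rewrite !nbhsE => -[A [oA Ax] AP].
  exists [set y | A (glued_class (b, y))]; last by move=> y /AP.
  by split=> //; move/glued_openP : oA; apply.
exists ((fun x => glued_class (b, x)) @` A); last by move=> _ [y Ay <-]; exact: AP.
by split; [exact: glued_class_open|exists x].
Qed.

Lemma glued_class_continuous b : continuous (fun x => glued_class (b, x)).
Proof. by move=> x P /glued_nbhsP. Qed.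

Lemma glued_continuousP (T : topologicalType) (f : glued_space -> T) b x :
  {for x, continuous (fun y => f (glued_class (b, y)))} <-> {for glued_class (b, x),
    continuous f}.
Proof.
split=> H P /H.
  by rewrite /nbhs /= => ?; apply/glued_nbhsP.
by move/glued_nbhsP.
Qed.

Lemma glued_chart_cod b : glued_chart b @` chart_dom (glued_chart b) = [set: E].
Proof.
apply/seteqP; split=> // x _; exists (glued_class (b, x)); first by exists x.
exact: glued_chartK.
Qed.

Lemma glued_chart_is_chart b : is_chart (glued_chart b).
Proof.
split.
- by apply: glued_class_open; exact: openT.
- by rewrite glued_chart_cod; exact: openT.
- by move=> w; rewrite inE => -[x _ <-]; rewrite glued_chartK.
- move=> _ [x _ <-]; apply/glued_continuousP.
  have -> : (fun y => glued_chart b (glued_class (b, y))) = id by apply/funext => y;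
    rewrite glued_chartK.
  exact: cvg_id.
- by move=> x _; exact: glued_class_continuous.
Qed.

Lemma glued_atlas c : @atlas R E glued c -> exists b, c = glued_chart b.
Proof. by case=> ->; [exists true|exists false]. Qed.

Lemma glued_chart_atlas b : @atlas R E glued (glued_chart b).
Proof. by case: b; [left|right]. Qed.

Lemma glued_chart_trans b x : O b x -> \forall y \near x,
  (glued_chart (~~ b) \o chart_inv (glued_chart b)) y = tau b y.
Proof.
move=> Ox; have : \forall y \near x, O b y.
  by apply: open_nbhs_nbhs; split=> //; exact: (glue_open G).
by apply: filterS => y Oy /=; exact: glued_chartN.
Qed.

Lemma glued_manifold : is_complex_manifold glued.
Proof.
split.
- rewrite open_hausdorff => w1 w2.
  have cross : forall x y, glued_class (true, x) <> glued_class (false, y) ->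
    exists A B : set glued_space, [/\ open A, A (glued_class (true, x)), open B,
      B (glued_class (false, y)) & A `&` B = set0].
    move=> x y ne; have nr : ~ (O true x /\ y = tau true x).
      by move=> [Ox E1]; apply: ne; rewrite E1 (glued_class_glue Ox).
    have [A [B [+ + AB]]] := glue_sep G nr.
    rewrite !nbhsE => -[A' [oA A'x] A'A] [B' [oB B'y] B'B].
    exists ((fun x => glued_class (true, x)) @` A'), ((fun x => glued_class (false, x)) @` B');
      split.
    + exact: glued_class_open.
    + by exists x.
    + exact: glued_class_open.
    + by exists y.
    apply/seteqP; split=> // _ [[a A'a <-] [c B'c /esym E1]].
    by apply: (AB _ _ (A'A _ A'a) (B'B _ B'c)); exact: (@glued_class_cross true).
  have same : forall b x y, glued_class (b, x) <> glued_class (b, y) ->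
    exists A B : set glued_space, [/\ open A, A (glued_class (b, x)), open B, B (glued_class (b,
      y)) & A `&` B = set0].
    move=> b x y ne; have xy : x != y by apply: contra_not_neq ne => ->.
    have := @norm_hausdorff _ E; rewrite open_hausdorff => /(_ _ _ xy).
    move=> [[A B] /= [Ax By] [oA oB /eqP AB]].
    rewrite inE in Ax; rewrite inE in By.
    exists ((fun x => glued_class (b, x)) @` A), ((fun x => glued_class (b, x)) @` B); split.
    + exact: glued_class_open.
    + by exists x.
    + exact: glued_class_open.
    + by exists y.
    apply/seteqP; split=> // _ [[a Aa <-] [c Bc /glued_class_same E1]].
    by have : (A `&` B) a; [split=> //; rewrite -E1|rewrite AB].
  move=> ne; suff [A [B [oA A1 oB B2 AB]]] : exists A B : set glued_space,
     [/\ open A, A w1, open B, B w2 & A `&` B = set0].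
    by exists (A, B); rewrite ?inE //=; split=> //; apply/eqP.
  have [b1 [x E1]] := glued_class_surj w1; have [b2 [y E2]] := glued_class_surj w2.
  have {}ne : w1 <> w2 by apply/eqP.
  move: ne; rewrite E1 E2; case: b1 {E1}; case: b2 {E2} => ne.
  + exact: same.
  + exact: cross.
  + have [|A [B [oA Ay oB By AB]]] := cross y x; first by apply/nesym.
    by exists B, A; split=> //; rewrite setIC.
  + exact: same.
- move=> [B cB [oB bB]].
  exists (\bigcup_(b in [set: bool]) ((fun U => (fun x => glued_class (b, x)) @` U) @` B)).
    apply: bigcup_countable; first exact: countableP.
    by move=> b _; apply: sub_countable cB; exact: card_image_le.
  split; first by move=> _ [b _ [U BU <-]]; apply: glued_class_open; exact: oB.
  move=> w P; have [b [x ->]] := glued_class_surj w; move=> /glued_nbhsP /bB.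
  move=> [U [BU Ux] UP]; exists ((fun x => glued_class (b, x)) @` U).
    split; last by exists x.
    by exists b => //; exists U.
  by move=> _ [y Uy <-]; exact: UP.
- by move=> c /glued_atlas [b ->]; exact: glued_chart_is_chart.
- by move=> w; have [b [x ->]] := glued_class_surj w; exists (glued_chart b);
    [exact: glued_chart_atlas|exists x].
- move=> c d /glued_atlas [b ->] /glued_atlas [b' ->] _ [x _ <-].
  rewrite glued_chartK; have [->|bb] := eqVneq b' b.
    have -> : glued_chart b \o chart_inv (glued_chart b) = id by apply/funext => y;
      exact: glued_chartK.
    by move=> _; apply: ex_diff.
  have -> := neq_negb bb.
  move=> /glued_class_domN Ox.
  apply: near_differentiable (glue_diff G Ox).
  by apply: filterS (glued_chart_trans Ox) => y ->.
Qed.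

End Glue.

(** * Maps between glued manifolds *)

Section ModelChart.
Variables (R : realType).
Notation C := (Cplx R).

Lemma comp_chart_inv (E : normedModType C) (e : equiv_rel (bool * E)) tau (T U : Type)
  (f : glued_space e -> T) (d : T -> U) b y :
  (d \o f \o chart_inv (glued_chart e tau b)) y = d (f (glued_class e (b, y))).
Proof. by []. Qed.

Lemma model_atlas (B : normedModType C) (c : chart B B) :
  @atlas R B (model B) c -> c = Chart [set: B] id id.
Proof. by []. Qed.

Lemma model_manifold (B : normedModType C) : is_complex_manifold (model B).
Proof.
split.
- exact: norm_hausdorff.
- by [].
- move=> c /model_atlas ->; split=> //=.
  + exact: openT.
  + by rewrite image_id; exact: openT.
  + by move=> x _; exact: cvg_id.
  + by move=> x _; exact: cvg_id.
- by move=> x; exists (Chart [set: B] id id).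
- by move=> c d /model_atlas -> /model_atlas -> x _ _; exact: ex_diff.
Qed.
End ModelChart.

Section Maps.
Variables (R : realType).
Notation C := (Cplx R).
Variables (E F : normedModType C).
Variables (e : equiv_rel (bool * E)) (tau : bool -> E -> E) (O : bool -> set E).
Variables (e' : equiv_rel (bool * F)) (tau' : bool -> F -> F) (O' : bool -> set F).
Hypotheses (G : glue_data e tau O) (G' : glue_data e' tau' O').
Variables (f : glued_space e -> glued_space e') (Phi : bool -> E -> F).
Hypothesis fE : forall b x, f (glued_class e (b, x)) = glued_class e' (b, Phi b x).

(** For a map given by Phi b from chart b to chart b, a local property of all coordinate
expressions reduces to that property for Phi b and for its composition with the transition map
of the target. *)
Lemma in_charts_glued (P : (E -> F) -> E -> Prop) (A : set (glued e tau)) :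
  (forall g h x, (\forall y \near x, g y = h y) -> P g x -> P h x) ->
  (forall b x, A (glued_class e (b, x)) -> {for x, continuous (Phi b)}) ->
  (forall b x, A (glued_class e (b, x)) -> P (Phi b) x) ->
  (forall b x, A (glued_class e (b, x)) -> O' b (Phi b x) -> P (tau' b \o Phi b) x) ->
  in_charts (M := glued e tau) (N := glued e' tau') P A f.
Proof.
move=> loc cPhi H1 H2 c d /glued_atlas [b ->] /glued_atlas [b' ->] w + [x _ xw]; rewrite -{w}xw.
rewrite (glued_chartK G) => Ax; rewrite [f _]fE.
have [->|bb] := eqVneq b' b.
  move=> _; apply: loc (H1 b x Ax); apply: nearW => y.
  by rewrite comp_chart_inv fE (glued_chartK G').
have -> := neq_negb bb.
move=> /(glued_class_domN G') Ox; apply: loc (H2 b x Ax Ox).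
have : \forall y \near x, O' b (Phi b y).
  by apply: (cPhi b x Ax (O' b)); apply: open_nbhs_nbhs; split=> //; exact: (glue_open G').
apply: filterS => y Oy.
by rewrite comp_chart_inv fE (glued_chartN G').
Qed.

Lemma glued_continuous b x : {for x, continuous (Phi b)} -> {for glued_class e (b, x),
  continuous f}.
Proof.
move=> cP; apply/(glued_continuousP G).
have -> : (fun y => f (glued_class e (b, y))) = (fun y => glued_class e' (b, y)) \o Phi b.
  by apply/funext => y /=; rewrite fE.
by apply: continuous_comp => //; exact: (glued_class_continuous G').
Qed.

Lemma glued_holomorphic : (forall b x, differentiable (Phi b) x) ->
  holomorphic (M := glued e tau) (N := glued e' tau') f.
Proof.
move=> dP; split.
  move=> w; have [b [x ->]] := glued_class_surj w.
  exact: glued_continuous (differentiable_continuous (dP b x)).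
apply: in_charts_glued => [g h x|b x _|b x _|b x _ Ox].
- exact: near_differentiable.
- exact: differentiable_continuous (dP b x).
- exact: dP.
- by apply: differentiable_comp; [exact: dP|exact: (glue_diff G')].
Qed.

(** In a chart of the target other than the expected one, the expression is tau' o Phi; tau' is
invertible near the point, so its differential loses no vector. *)
Lemma glued_immersion : (forall b x, differentiable (Phi b) x) ->
  (forall b x, injective ('d (Phi b) x : E -> F)) ->
  immersion (M := glued e tau) (N := glued e' tau') f.
Proof.
move=> dP iP c d ac ad x _ cx dx.
(* The property proved in all charts includes differentiability, without which [near_diff] and
   the chain rule do not apply. *)
pose P (g : E -> F) y := differentiable g y /\ injective ('d g y : E -> F).
suff /(_ c d ac ad x I cx dx) [] : in_charts (M := glued e tau) (N :=
  glued e' tau') P [set: _] f by [].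
apply: in_charts_glued => {c d ac ad x cx dx} [g h x gh [dg ig]|b x _|b x _|b x _ Ox].
- have [dh dE] := near_diff gh dg; split; first exact: dh.
  have dE' z : 'd h x z = 'd g x z := congr1 (fun k : E -> F => k z) dE.
  move=> u v uv; apply: ig.
  exact: etrans (esym (dE' u)) (etrans uv (dE' v)).
- exact: differentiable_continuous (dP b x).
- by split; [exact: dP|exact: iP].
have dt := glue_diff G' Ox; have dt' := glue_diff G' (glue_dom G' Ox).
have dg : differentiable (tau' b \o Phi b) x by apply: differentiable_comp.
split=> //.
have nr : \forall y \near x, (tau' (~~ b) \o (tau' b \o Phi b)) y = Phi b y.
  have : \forall y \near x, O' b (Phi b y).
    apply: (differentiable_continuous (dP b x)).
    by apply: open_nbhs_nbhs; split=> //; exact: (glue_open G').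
  by apply: filterS => y Oy /=; rewrite (glueK G').
have dc : differentiable (tau' (~~ b) \o (tau' b \o Phi b)) x.
  exact: differentiable_comp.
have [_ E1] := near_diff nr dc.
have E2 z : 'd (Phi b) x z = 'd (tau' (~~ b)) (tau' b (Phi b x)) ('d (tau' b \o Phi b) x z).
  have E3 := congr1 (fun k : E -> F => k z) (diff_comp dg dt').
  have E4 := congr1 (fun k : E -> F => k z) E1.
  exact: etrans E4 E3.
move=> u v uv; apply: (iP b x).
exact: etrans (E2 u) (etrans (congr1 _ uv) (esym (E2 v))).
Qed.

End Maps.

(** * Families of glued manifolds *)

Section Family.
Variables (R : realType).
Notation C := (Cplx R).
Variables (E B : normedModType C).
Variables (O : bool -> set E) (tauF : B -> bool -> E -> E).
Variables (e' : equiv_rel (bool * (E * B))).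
Definition total_tau (b : bool) (p : E * B) : E * B := (tauF p.2 b p.1, p.2).
Definition total_dom (b : bool) : set (E * B) := O b `*` [set: B].
Notation tau' := total_tau.
Hypothesis G' : glue_data e' tau' total_dom.
Notation XX := (glued e' tau').

Definition total_proj (w : XX) : B := (repr (w : {eq_quot e'})).2.2.

Lemma total_projE b p : total_proj (glued_class e' (b, p)) = p.2.
Proof. exact: (glued_liftE G' (f := fun _ p => p.2)). Qed.

Lemma snd_is_diff (p : E * B) : is_diff p snd snd.
Proof.
apply: DiffDef.
  by apply: (@linear_differentiable _ _ _ snd) => x; exact: cvg_snd.
by apply: (@diff_lin _ _ _ snd) => x; exact: cvg_snd.
Qed.

Lemma total_proj_holomorphic : holomorphic (M := XX) (N := model B) total_proj.
Proof.
split.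
  move=> w; have [b [x ->]] := glued_class_surj w; apply/(glued_continuousP G').
  have -> : (fun y => total_proj (glued_class e' (b, y))) = snd.
    by apply/funext => y; rewrite total_projE.
  exact: cvg_snd.
move=> c d /glued_atlas [b ->] /model_atlas -> w _ [p _ <-] _.
rewrite (_ : _ \o _ = snd); last by apply/funext => y; rewrite comp_chart_inv total_projE.
by have := snd_is_diff (glued_chart e' tau' b (glued_class e' (b, p))) => ?; exact: ex_diff.
Qed.

Lemma total_proj_submersion : submersion (M := XX) (N := model B) total_proj.
Proof.
move=> c d /glued_atlas [b ->] /model_atlas -> w0 _ [p _ <-] _ w.
rewrite (_ : _ \o _ = snd); last by apply/funext => y; rewrite comp_chart_inv total_projE.
exists (0, w); have := snd_is_diff (glued_chart e' tau' b (glued_class e' (b, p))) => ?.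
by rewrite diff_val.
Qed.

Lemma total_proj_range : range total_proj = [set: B].
Proof.
apply/seteqP; split=> // t _; exists (glued_class e' (true, (0, t))) => //.
by rewrite total_projE.
Qed.

Section Fiber.
Variables (t : B) (e : equiv_rel (bool * E)) (tau : bool -> E -> E).
Hypothesis G : glue_data e tau O.
Hypothesis tauE : forall b x, O b x -> tau b x = tauF t b x.

Definition fiber_incl (w : glued_space e) : glued_space e' :=
  let q := repr (w : {eq_quot e}) in glued_class e' (q.1, (q.2, t)).

Lemma fiber_inclE b x : fiber_incl (glued_class e (b, x)) = glued_class e' (b, (x, t)).
Proof.
apply: (glued_liftE G (f := fun b x => glued_class e' (b, (x, t)))) => {}b {}x Ox.
have Ox' : total_dom b (x, t) by [].
by rewrite -(glued_class_glue G' Ox') /total_tau /= tauE.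
Qed.

Lemma pair_is_diff (x : E) : is_diff x (fun y : E => (y, t)) (fun y => (y, 0)).
Proof. exact: is_diff_pair. Qed.

(** The fibre over t is included by x |-> (x, t) in both charts. An open set U of the fibre is
the trace of the union of the images of U * B in the two charts, hence the embedding. *)
Lemma total_fiber : is_fiber (X := XX) total_proj t (glued e tau).
Proof.
split; first exact: glued_manifold G.
have dP (b : bool) x : differentiable (fun y : E => (y, t)) x.
  by have := pair_is_diff x => ?; exact: ex_diff.
exists fiber_incl; split.
- exact: (glued_holomorphic G G' fiber_inclE dP).
- split.
  + by have [] := glued_holomorphic G G' fiber_inclE dP.
  + move=> w1 w2; have [b1 [x1 ->]] := glued_class_surj w1;
      have [b2 [x2 ->]] := glued_class_surj w2.
    rewrite !fiber_inclE; have [->|bb] := eqVneq b2 b1.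
      by move=> /(glued_class_same G') [->].
    have -> := neq_negb bb.
    move=> /(glued_class_cross G') [[/= Ox _] [->]].
    by rewrite -(tauE Ox) (glued_class_glue G).
  + move=> U oU.
    pose V : set (glued_space e') := \bigcup_b ((fun p => glued_class e' (b,
      p)) @` ([set x | U (glued_class e (b, x))] `*` [set: B])).
    exists V.
      apply: bigcup_open => b _; apply: (glued_class_open G'); apply: open_setXT.
      by move/glued_openP : oU; apply.
    apply/seteqP; split=> w; have [b [x ->]] := glued_class_surj w;
      rewrite /preimage /= fiber_inclE.
      move=> [b' _ [[y s] [/= Uy _]]].
      have [->|bb] := eqVneq b b'; first by move=> /(glued_class_same G') [<- _].
      have -> := neq_negb bb.
      move=> /(glued_class_cross G') [[/= Oy _] [-> <-]].
      by rewrite -(tauE Oy) (glued_class_glue G).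
    by move=> Ux; exists b => //; exists (x, t).
- apply: (glued_immersion G G' fiber_inclE dP) => b x u v.
  have := pair_is_diff x => ?; rewrite diff_val.
  by case.
- apply/seteqP; split=> [_ [w _ <-]|w].
    by have [b [x ->]] := glued_class_surj w; rewrite /= fiber_inclE total_projE.
  have [b [[x s] ->]] := glued_class_surj w; rewrite /= total_projE /= => ->.
  by exists (glued_class e (b, x)); rewrite ?fiber_inclE.
Qed.

End Fiber.

Section Trivial.
Variables (e : equiv_rel (bool * E)) (tau : bool -> E -> E).
Hypothesis G : glue_data e tau O.
Notation Y := (glued e tau).
Variables (Phi Psi : bool -> E * B -> E).
Hypothesis PhiE : forall b x t, O b x -> Phi (~~ b) (tauF t b x, t) = tau b (Phi b (x, t)).
Hypothesis PhiO : forall b x t, O b x -> O b (Phi b (x, t)).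
Hypothesis PsiO : forall b x t, O b x -> O b (Psi b (x, t)).
Hypothesis PhiK : forall b x t, Psi b (Phi b (x, t), t) = x.
Hypothesis PsiK : forall b x t, Phi b (Psi b (x, t), t) = x.
Hypothesis sPhi : forall b n, Cn_on n [set: E * B] (Phi b).
Hypothesis sPsi : forall b n, Cn_on n [set: E * B] (Psi b).
Hypothesis sPhiN : forall b n,
  Cn_on n [set p | O b (Phi b p)] (fun p => tau b (Phi b p)).
Hypothesis sPsiN : forall b n,
  Cn_on n [set p | O b (Psi b p)] (fun p => tauF p.2 b (Psi b p)).

Lemma PsiE b x t : O b x -> Psi (~~ b) (tau b x, t) = tauF t b (Psi b (x, t)).
Proof.
move=> Ox; have := PhiE t (PsiO t Ox); rewrite PsiK => <-.
by rewrite PhiK.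
Qed.

(** [Phi b], for each parameter, is a change of coordinates of chart b that conjugates the
transition map of the family to that of the fixed fibre. *)
Definition trivialization (w : glued_space e') : product_mfd Y (model B) :=
  let q := repr (w : {eq_quot e'}) in (glued_class e (q.1, Phi q.1 q.2), q.2.2).

Lemma trivializationE b p : trivialization (glued_class e' (b, p)) =
  (glued_class e (b, Phi b p), p.2).
Proof.
apply: (glued_liftE G' (f := fun b p => (glued_class e (b, Phi b p),
  p.2))) => {p}b [x t] [/= Ox _].
rewrite /total_tau /= PhiE //; congr pair.
by apply: (glued_class_glue G); exact: PhiO.
Qed.

Definition untrivialization (q : product_mfd Y (model B)) : glued_space e' :=
  let p := repr (q.1 : {eq_quot e}) in glued_class e' (p.1, (Psi p.1 (p.2, q.2), q.2)).

Lemma untrivializationE b x t : untrivialization (glued_class e (b, x), t) =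
  glued_class e' (b, (Psi b (x, t), t)).
Proof.
apply: (glued_liftE G (f := fun b x => glued_class e' (b, (Psi b (x, t), t)))) => {}b {}x Ox.
rewrite PsiE // -[in RHS](glued_class_glue G') //.
by split=> //=; exact: PsiO.
Qed.

Lemma open_preimage_dom (f : E * B -> E) b : (forall n, Cn_on n [set: E * B] f) ->
  open [set p | O b (f p)].
Proof.
move=> sf; have /continuousP : continuous f by move=> p; exact: (Cn_continuous (sf 0%N)).
by apply; exact: (glue_open G).
Qed.

(** Coordinate expressions of the trivialization are Phi itself or its composition with a
transition map, according to the chart of the target; this is why the smoothness of both is
assumed. *)
Lemma total_trivialization :
  smooth_trivialization (X := Y) (XX := XX) total_proj [set: B] trivialization untrivialization.
Proof.
have cPhi b : continuous (Phi b) by move=> p; exact: (Cn_continuous (sPhi b 0%N)).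
have cPsi b : continuous (Psi b) by move=> p; exact: (Cn_continuous (sPsi b 0%N)).
have sn (U : set (E * B)) n : open U -> Cn_on n U snd.
  by move=> oU; apply: Cn_rlin => //; exact: real_linear_snd.
split.
- split.
    move=> w _; have [b [p ->]] := glued_class_surj w; apply/(glued_continuousP G').
    have -> : (fun y => trivialization (glued_class e' (b, y))) =
      fun y => (glued_class e (b, Phi b y), y.2).
      by apply/funext => y; rewrite trivializationE.
    have c1 : {for p, continuous (fun y => glued_class e (b, Phi b y))}.
      apply: (@continuous_comp _ _ _ (Phi b) (fun x => glued_class e (b, x))); first exact: cPhi.
      exact: (glued_class_continuous G).
    have c2 : {for p, continuous (@snd E B)} by exact: cvg_snd.
    move=> P [[A1 A2] /= [n1 n2] sA].
    have F := nbhs_filter p.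
    have m1 : nbhs p (fun q => A1 (glued_class e (b, Phi b q))) := c1 _ n1.
    have m2 : nbhs p (fun q => A2 q.2) := c2 _ n2.
    suff : nbhs p (fun q => P (glued_class e (b, Phi b q), q.2)) by [].
    by move: m1 m2; apply: filterS2 => q q1 q2; exact: (sA (_, _)).
  move=> c d /glued_atlas [b ->] [d1 [d2 [/glued_atlas [b' ->] /model_atlas -> ->]]].
  move=> w _ [p _ <-]; rewrite (glued_chartK G') trivializationE => -[+ _].
  have [->|bb] := eqVneq b' b.
    move=> _; exists [set: E * B]; split=> //; first exact: openT.
    move=> n; apply: (Cn_ext _ _ (Cn_pair _ (sPhi b n) (sn _ n _))); try exact: openT.
    by move=> q _; rewrite comp_chart_inv trivializationE -[RHS]/(glued_chart e tau b
      (glued_class e (b, Phi b q)), q.2) (glued_chartK G).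
  have -> := neq_negb bb.
  move=> /(glued_class_domN G) Op; have oU := open_preimage_dom (b := b) (sPhi b).
  exists [set p | O b (Phi b p)]; split=> // n.
  apply: (Cn_ext oU _ (Cn_pair oU (sPhiN b n) (sn _ n oU))).
  by move=> q Oq; rewrite comp_chart_inv trivializationE -[RHS]/(glued_chart e tau (~~ b)
    (glued_class e (b, Phi b q)), q.2) (glued_chartN G).
- split.
    move=> [w t] _; have [b [p ->]] := glued_class_surj w.
    move=> P; rewrite untrivializationE => /(glued_nbhsP G') NP.
    have cc : {for (p, t), continuous (fun q : E * B => (Psi b q, q.2))}.
      by apply: cvg_pair; [exact: cPsi|exact: cvg_snd].
    have := cc _ NP => -[[A1 A2] /= [nA1 nA2] sA].
    exists ((fun x => glued_class e (b, x)) @` A1, A2) => /=.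
      split=> //; apply/(glued_nbhsP G); apply: filterS nA1 => x A1x; by exists x.
    move=> [_ s] /= [[x A1x <-] A2s]; rewrite untrivializationE.
    exact: (sA (x, s)).
  move=> c d [c1 [c2 [/glued_atlas [b ->] /model_atlas -> ->]]] /glued_atlas [b' ->].
  move=> [w t] _ [[x _ ew] _]; have {}ew : glued_class e (b, x) = w := ew;
    rewrite -{w}ew untrivializationE.
  have cE : chart_fun (product_chart (glued_chart e tau b) (Chart [set: B] id id)) (glued_class e
    (b, x), t) = (x, t).
    by rewrite -[LHS]/(glued_chart e tau b (glued_class e (b, x)), t) (glued_chartK G).
  rewrite cE.
  have [->|bb] := eqVneq b' b.
    move=> _; exists [set: E * B]; split=> //; first exact: openT.
    move=> n; apply: (Cn_ext _ _ (Cn_pair _ (sPsi b n) (sn _ n _))); try exact: openT.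
    move=> [q s] _; rewrite -[RHS]/(glued_chart e' tau' b (untrivialization (glued_class e (b,
      q), s))).
    by rewrite untrivializationE (glued_chartK G').
  have -> := neq_negb bb.
  move=> /(glued_class_domN G') [/= Op _]; have oU := open_preimage_dom (b := b) (sPsi b).
  exists [set p | O b (Psi b p)]; split=> // n.
  apply: (Cn_ext oU _ (Cn_pair oU (sPsiN b n) (sn _ n oU))).
  move=> [q s] Oq; rewrite -[RHS]/(glued_chart e' tau' (~~ b) (untrivialization (glued_class e
    (b, q), s))).
  by rewrite untrivializationE (glued_chartN G').
- move=> y _; have [b [[x t] ->]] := glued_class_surj y.
  by rewrite trivializationE total_projE /= untrivializationE PhiK.
- move=> [w t] _; have [b [x ->]] := glued_class_surj w.
  by rewrite untrivializationE total_projE trivializationE /= PsiK.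
Qed.

Lemma total_deformation_family (t0 : B) : t0 = 0 ->
  (forall b x, O b x -> tau b x = tauF t0 b x) ->
  deformation_family Y (XX := XX) [set: B] total_proj.
Proof.
move=> t00 tauE; split.
- by left.
- exact: glued_manifold G'.
- exact: total_proj_holomorphic.
- exact: total_proj_submersion.
- exact: total_proj_range.
- by rewrite -t00; exact: (total_fiber G tauE).
- move=> t _; exists [set: B]; split=> //; first exact: openT.
  by exists trivialization, untrivialization; exact: total_trivialization.
Qed.

End Trivial.
End Family.

(** * Completeness and coordinates of C^3 *)

Section Completeness.
Variable R : realType.
Notation C := (Cplx R).

Lemma cauchy_image (T U : pseudoMetricType C) (f : T -> U) (G : set_system T) :
  (forall x y e, ball x e y -> ball (f x) e (f y)) -> ProperFilter G ->
  cauchy G -> cauchy (f @ G).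
Proof.
move=> lip PG /cauchyP cG; apply: cauchy_exP => e e0.
have [x Gx] := cG e e0; exists (f x).
suff : G (f @^-1` ball (f x) e) by [].
by apply: filterS Gx => y By; apply: lip.
Qed.

(** A Cauchy filter converges because its images by the real and imaginary parts do. *)
Lemma complete_C : complete_normed (C : normedModType C).
Proof.
move=> G PG /cauchyP cG.
have cvgp (p : C -> R) : (forall z w, `|p z - p w| <= cmod (z - w)) -> cvg (p @ G).
  move=> lip; apply: cauchy_cvg; apply: cauchy_exP => e e0.
  have e0' : 0 < ofR e by rewrite -(ofR0 R) ofR_lt.
  have [z Gz] := cG (ofR e) e0'; exists (p z).
  suff : G (p @^-1` ball (p z) e) by [].
  apply: filterS Gz => w zw; have {}zw : cmod (z - w) < e.
    by move: zw; rewrite -ball_normE /= cmodE ofR_lt.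
  by rewrite /preimage /= -ball_normE /=; apply: le_lt_trans zw.
have /cvg_ex [a Ha] : cvg (@rePart R @ G).
  by apply: cvgp => z w; rewrite -ReN -ReD Re_le_cmod.
have /cvg_ex [b Hb] : cvg (@imPart R @ G).
  by apply: cvgp => z w; rewrite -ImN -ImD Im_le_cmod.
apply/cvg_ex; exists (ofR a + iC R * ofR b).
have -> : G = (fun z => ofR (rePart z) + iC R * ofR (imPart z)) @ G.
  by apply/seteqP; split=> P GP; rewrite /= /nbhs /= in GP *; apply: filterS GP => z;
    rewrite /= -complexReIm.
apply: cvgD; first by apply: cvg_comp Ha _; exact: ofR_continuous.
apply: cvgM; first exact: cvg_cst.
by apply: cvg_comp Hb _; exact: ofR_continuous.
Qed.

Lemma complete_prod (E F : normedModType C) :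
  complete_normed E -> complete_normed F -> complete_normed (E * F)%type.
Proof.
move=> cE cF G PG cG.
have /cvg_ex [a Ha] : cvg (fst @ G).
  by apply: cE; apply: cauchy_image cG => x y e [].
have /cvg_ex [b Hb] : cvg (snd @ G).
  by apply: cF; apply: cauchy_image cG => x y e [].
apply/cvg_ex; exists (a, b) => P [[A B] /= [nA nB] sP].
have gA : G (fst @^-1` A) := Ha _ nA; have gB : G (snd @^-1` B) := Hb _ nB.
suff : G P by [].
by apply: filterS (filterI gA gB) => -[x y] [/= Ax By]; exact: (sP (x, y)).
Qed.

Lemma real_linear_coord (i : 'I_3) : real_linear (fun x : 'rV[C]_3 => x 0 i : C).
Proof.
split=> [|x y|h x]; [exact: coord_continuous|by rewrite mxE|by rewrite mxE].
Qed.

Lemma real_linear_delta (i : 'I_3) : real_linear (fun c : C => c *: (delta_mx 0 i : 'rV[C]_3)).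
Proof.
split=> [x|x y|h x]; [|by rewrite scalerDl|by rewrite scalerA].
exact: scalel_continuous.
Qed.

Lemma vec3_sum (a b c : C) : vec3 a b c =
  a *: delta_mx 0 0 + b *: delta_mx 0 1 + c *: delta_mx 0 2.
Proof.
by apply/rowP => -[[|[|[|//]]] Hi]; rewrite !mxE /= ?(mulr1, mulr0, addr0, add0r).
Qed.

Lemma vec3_cvg (T : Type) (G : set_system T) (FG : Filter G) (f g h : T -> C) (a b c : C) :
  f @ G --> a -> g @ G --> b -> h @ G --> c ->
  (fun t => vec3 (f t) (g t) (h t)) @ G --> vec3 a b c.
Proof.
move=> Hf Hg Hh; rewrite vec3_sum.
have -> : (fun t => vec3 (f t) (g t) (h t)) = fun t =>
  f t *: delta_mx 0 0 + g t *: delta_mx 0 1 + h t *: delta_mx 0 2.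
  by apply/funext => t; rewrite vec3_sum.
have Z (i : 'I_3) (u : T -> C) (p : C) : u @ G --> p ->
    (fun t => u t *: (delta_mx 0 i : 'rV[C]_3)) @ G --> p *: (delta_mx 0 i : 'rV[C]_3).
  move=> Hu; have [cd _ _] := real_linear_delta i.
  by apply: (@cvg_comp _ _ _ u (fun c : C => c *: (delta_mx 0 i : 'rV[C]_3)) _ _ _ Hu); exact: cd.
exact: (cvgD (cvgD (Z 0 f a Hf) (Z 1 g b Hg)) (Z 2 h c Hh)).
Qed.

Lemma complete_rV3 : complete_normed 'rV[C]_3.
Proof.
move=> G PG cG.
have H i : cvg ((fun x : 'rV[C]_3 => x 0 i) @ G).
  by apply: complete_C; apply: cauchy_image cG => x y e [].
have /cvg_ex [a Ha] := H 0; have /cvg_ex [b Hb] := H 1; have /cvg_ex [c Hc] := H 2.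
apply/cvg_ex; exists (vec3 a b c).
have V := @vec3_cvg _ G PG (fun x : 'rV[C]_3 => x 0 0) (fun x : 'rV[C]_3 => x 0 1)
  (fun x : 'rV[C]_3 => x 0 2) a b c Ha Hb Hc.
move=> P nP; have GP : G [set x : 'rV[C]_3 | P (vec3 (x 0 0) (x 0 1) (x 0 2))] := V _ nP.
suff : G P by [].
by apply: filterS GP => x /=; rewrite vec3_eta.
Qed.

Lemma Cn_vec3 n (E : normedModType C) (U : set E) (f g h : E -> C) : open U ->
  Cn_on n U f -> Cn_on n U g -> Cn_on n U h ->
  Cn_on n U (fun x => vec3 (f x) (g x) (h x)).
Proof.
move=> oU Hf Hg Hh.
have H := CnD oU (CnD oU (Cn_postcomp oU (real_linear_delta 0) Hf) (Cn_postcomp oU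
  (real_linear_delta 1) Hg))
  (Cn_postcomp oU (real_linear_delta 2) Hh).
by apply: Cn_ext H => // x _; rewrite vec3_sum.
Qed.

Lemma differentiable_vec3 (E : normedModType C) (f g h : E -> C) x :
  differentiable f x -> differentiable g x -> differentiable h x ->
  differentiable (fun x => vec3 (f x) (g x) (h x)) x.
Proof.
move=> Hf Hg Hh.
have -> : (fun t => vec3 (f t) (g t) (h t)) = ((fun t => f t *: (delta_mx 0 0 : 'rV[C]_3)) +
  (fun t => g t *: (delta_mx 0 1 : 'rV[C]_3))) + (fun t => h t *: (delta_mx 0 2 : 'rV[C]_3)).
  by apply/funext => t; rewrite vec3_sum.
by apply: differentiableD; [apply: differentiableD|]; apply: differentiableZl.
Qed.

Definition cconj (z : C) : C := conjc (z : R[i]).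
Lemma real_linear_conj : real_linear cconj.
Proof.
split=> [z|z w|h z].
- have F := nbhs_filter z; apply/cvg_cmodP => e e0; apply/near_cmodP; exists e => // w.
  by rewrite !cmod_sqrt; case: w => a b; case: {F} z => c d;
    rewrite /rePart /imPart /= -opprD sqrrN.
- exact: (rmorphD (@conjc R)).
- by apply: (etrans (rmorphM (@conjc R) _ _)); congr (_ * _); exact: conjc_real.
Qed.

Lemma mul_conj (z : C) : z * cconj z = ofR (cmod z ^+ 2).
Proof.
by have := sqr_normc (z : R[i]) => <-; rewrite -[`|_|]/(`|z : C|) cmodE expr2 -ofRM.
Qed.

End Completeness.

(** * Gluing along the complement of the zeros of a coordinate *)

Lemma open_neqC (R : realType) (a : Cplx R) : open [set z : Cplx R | z != a].
Proof.
rewrite openE => z za; apply/near_cmodP; exists (cmod (z - a)).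
  by rewrite lt_neqAle eq_sym cmod_eq0 subr_eq0 za cmod_ge0.
by move=> w; apply: contraTneq => ->; rewrite cmodC ltxx.
Qed.

Section GlueIntro.
Variables (R : realType).
Notation C := (Cplx R).
Variables (E : normedModType C) (tau : bool -> E -> E) (c : E -> C).
Definition nonzero_dom (b : bool) : set E := [set x | c x != 0].
Hypothesis cc : continuous c.
Hypothesis ctau : forall b x, c x != 0 -> c (tau b x) = (c x)^-1.
Hypothesis tauK : forall b x, c x != 0 -> tau (~~ b) (tau b x) = x.
Hypothesis dtau : forall b x, c x != 0 -> differentiable (tau b) x.

Definition glue_relation (p q : bool * E) : bool :=
  `[< p = q \/ [/\ q.1 = ~~ p.1, nonzero_dom p.1 p.2 & q.2 = tau p.1 p.2] >].

Lemma glue_relationP p q : reflect (p = q \/ [/\ q.1 = ~~ p.1, nonzero_dom p.1 p.2 & q.2 =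
  tau p.1 p.2]) (glue_relation p q).
Proof. exact: asboolP. Qed.

Lemma c_tau_neq0 b x : c x != 0 -> c (tau b x) != 0.
Proof. by move=> cx; rewrite ctau // invr_eq0. Qed.

Lemma glue_relation_sym p q : glue_relation p q -> glue_relation q p.
Proof.
move=> /glue_relationP [->|[q1 Op q2]]; apply/glue_relationP; first by left.
by right; rewrite q1 q2 negbK; split=> //; [exact: c_tau_neq0|rewrite tauK].
Qed.

Lemma glue_relation_equiv : equiv_class_of glue_relation.
Proof.
split.
- by move=> p; apply/glue_relationP; left.
- by move=> p q; apply/idP/idP; exact: glue_relation_sym.
- move=> q p r /glue_relationP [->//|[q1 Op q2]] /glue_relationP [<-|[r1 Oq r2]];
    apply/glue_relationP.
    by right.
  left; rewrite [p]surjective_pairing [r]surjective_pairing r1 r2 q1 q2 negbK.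
  by rewrite tauK.
Qed.

Definition glue_equiv : equiv_rel (bool * E) := EquivRelPack glue_relation_equiv.

(** The transition maps invert the coordinate c. Hence two points x and y of different charts
that are not glued are separated either by c x * c y <> 1, or, when this product is 1 and x is
in the domain of the transition map, by y <> tau x. *)
Lemma glue_data_intro (e : equiv_rel (bool * E)) :
  (forall p q, e p q <-> p = q \/ [/\ q.1 = ~~ p.1, nonzero_dom p.1 p.2 & q.2 = tau p.1 p.2]) ->
  glue_data e tau nonzero_dom.
Proof.
move=> eP; split=> //.
- move=> b; have /continuousP := cc.
  move=> /(_ [set z | z != 0]); apply.
  exact: open_neqC.
- by move=> b x; exact: c_tau_neq0.
- move=> x y nr.
  have [xy1|xy1] := eqVneq (c x * c y) 1; last first.
    have : \forall p \near (x, y), c p.1 * c p.2 != 1.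
      have cm : (fun p : E * E => c p.1 * c p.2) @ (x, y) --> c x * c y.
        apply: cvgM; first by apply: cvg_comp cvg_fst _; exact: cc.
        by apply: cvg_comp cvg_snd _; exact: cc.
      have n1 : nbhs (c x * c y) [set z | z != 1] by apply: open_nbhs_nbhs; split;
        [exact: open_neqC|exact: xy1].
      exact: cm n1.
    move=> [[A B] /= [nA nB] sAB]; exists A, B; split=> // a b Aa Bb [Oa bE].
    have := sAB (a, b) (conj Aa Bb); rewrite /= bE ctau // mulfV ?eqxx //.
  have cx : c x != 0.
    by apply/eqP => cx0; move: xy1; rewrite cx0 mul0r => /esym/eqP; rewrite oner_eq0.
  have yt : y - tau true x != 0.
    by rewrite subr_eq0; apply/eqP => yE; apply: nr.
  have : \forall p \near (x, y), p.2 - tau true p.1 != 0.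
    have cm : (fun p : E * E => p.2 - tau true p.1) @ (x, y) --> y - tau true x.
      apply: cvgB; first exact: cvg_snd.
      by apply: cvg_comp cvg_fst _; exact: differentiable_continuous (dtau true cx).
    have oE : open [set u : E | u != 0].
      have /continuousP : continuous (fun u : E => `|u|) by exact: norm_continuous.
      move=> /(_ _ (@open_neqC R 0)).
      by congr open; apply/seteqP; split=> u /=; rewrite normr_eq0.
    have n1 : nbhs (y - tau true x) [set u | u != 0] by apply: open_nbhs_nbhs; split.
    exact: cm n1.
  move=> [[A B] /= [nA nB] sAB]; exists A, B; split=> // a b Aa Bb [Oa bE].
  by have := sAB (a, b) (conj Aa Bb); rewrite /= bE subrr eqxx.
Qed.

Lemma glue_equiv_data : glue_data glue_equiv tau nonzero_dom.
Proof. by apply: glue_data_intro => p q; split=> /glue_relationP. Qed.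

End GlueIntro.

Section Calculus.
Variables (R : realType).
Notation C := (Cplx R).

(** The polynomial y (y - 1) ... (y - n + 1), chosen because it has exactly n simple roots. *)
Definition falling (n : nat) (y : C) : C := \prod_(i < n) (y - i%:R).

Variable E : normedModType C.
Implicit Types f g : E -> C.

Lemma df_D f g x : differentiable f x -> differentiable g x -> differentiable (fun y => f y + g
  y) x.
Proof. exact: differentiableD. Qed.
Lemma df_N f x : differentiable f x -> differentiable (fun y => - f y) x.
Proof. exact: differentiableN. Qed.
Lemma df_M f g x : differentiable f x -> differentiable g x -> differentiable (fun y => f y * g
  y) x.
Proof. exact: differentiableM. Qed.
Lemma df_cst c x : differentiable (fun _ : E => c : C) x.
Proof. exact: differentiable_cst. Qed.
Lemma df_X f n x : differentiable f x -> differentiable (fun y => f y ^+ n) x.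
Proof.
move=> df; elim: n => [|n IH]; first exact: differentiable_cst.
have -> : (fun y => f y ^+ n.+1) = (fun y => f y * f y ^+ n) by apply/funext => y; rewrite exprS.
exact: df_M.
Qed.
Lemma df_falling n f x : differentiable f x -> differentiable (fun y => falling n (f y)) x.
Proof.
move=> df; elim: n => [|n IH].
  have -> : (fun y => falling 0 (f y)) = fun=> 1 by apply/funext => y; rewrite /falling big_ord0.
  exact: df_cst.
have -> : (fun y => falling n.+1 (f y)) = (fun y => falling n (f y) * (f y + - n%:R)).
  by apply/funext => y; rewrite /falling big_ord_recr.
exact: df_M IH (df_D df (df_cst _ _)).
Qed.
Lemma df_coord (i : 'I_3) (F : E -> 'rV[C]_3) x : differentiable F x -> differentiable (fun y =>
  F y 0 i) x.
Proof.
move=> dF; apply: (@differentiable_comp _ _ _ _ F (fun M : 'rV[C]_3 => M 0 i)) => //.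
exact: differentiable_coord.
Qed.

Variable U : set E.
Hypothesis oU : open U.
Lemma cn_B n f g : Cn_on n U f -> Cn_on n U g -> Cn_on n U (fun y => f y - g y).
Proof. by move=> Hf Hg; apply: CnD => //; exact: CnN. Qed.
Lemma cn_X n f m : Cn_on n U f -> Cn_on n U (fun y => f y ^+ m).
Proof.
move=> Hf; elim: m => [|m IH]; first exact: Cn_cst.
have -> : (fun y => f y ^+ m.+1) = (fun y => f y * f y ^+ m) by apply/funext => y; rewrite exprS.
exact: CnM.
Qed.
Lemma cn_falling n m f : Cn_on n U f -> Cn_on n U (fun y => falling m (f y)).
Proof.
move=> Hf; elim: m => [|m IH].
  have -> : (fun y => falling 0 (f y)) = fun=> 1 by apply/funext => y; rewrite /falling big_ord0.
  exact: Cn_cst.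
have -> : (fun y => falling m.+1 (f y)) = (fun y => falling m (f y) * (f y - m%:R)).
  by apply/funext => y; rewrite /falling big_ord_recr.
by apply: CnM => //; apply: cn_B => //; exact: Cn_cst.
Qed.
Lemma cn_conj n f : Cn_on n U f -> Cn_on n U (fun y => cconj (f y)).
Proof. by move=> Hf; apply: (Cn_postcomp oU (@real_linear_conj R)). Qed.
Lemma cn_coord n (i : 'I_3) (F : E -> 'rV[C]_3) : Cn_on n U F -> Cn_on n U (fun y => F y 0 i : C).
Proof. by move=> HF; apply: (Cn_postcomp oU (@real_linear_coord R i) HF). Qed.

End Calculus.

Ltac differentiable_tac := repeat first
  [ assumption | apply: df_D | apply: df_N | apply: df_M | apply: df_X | apply: df_falling |
    apply: df_coord
  | exact: df_cst | apply: differentiableV ].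

(** * The family of gluings through W_k *)

Section Concrete.
Variables (R : realType) (k n : nat).
Notation C := (Cplx R).
Notation V3 := 'rV[C]_3.

(** The gluing maps of the family. The number (z^-1)^k z^2 stands for z^(2-k), the two being
equal for z <> 0; in chart false, y is the value of the global function equal to u1 in chart
true. *)
Definition transition (t : C) (b : bool) (x : V3) : V3 :=
  let z := x 0 0 in
  if b then
    vec3 z^-1 (z ^+ k * x 0 1 + t * (z ^+ 2 * x 0 2 + t * (z * falling n (x 0 1))))
      (z^-1 ^+ k * z ^+ 2 * x 0 2 + t * (z^-1 ^+ k * z * falling n (x 0 1)))
  else
    let y := z ^+ k * x 0 1 + - (t * x 0 2) in
    vec3 z^-1 y (z^-1 ^+ k * z ^+ 2 * x 0 2 + - (t * (z * falling n y))).

Lemma transition_z t b (x : V3) : transition t b x 0 0 = (x 0 0)^-1.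
Proof. by rewrite /transition; case: b; rewrite vec3E. Qed.

(** In both directions the point is that y = xi^k v1 - t v2 equals u1. *)
Lemma transitionK t b (x : V3) : x 0 0 != 0 -> transition t (~~ b) (transition t b x) = x.
Proof.
move=> z0; rewrite -[RHS]vec3_eta /transition; case: b => /=; rewrite !vec3E invrK.
all: move: (x 0 0) (x 0 1) (x 0 2) z0 => z u v z0; rewrite !exprVn.
- have A0 : z ^+ k != 0 by rewrite expf_neq0.
  have y : (z ^+ k)^-1 * (z ^+ k * u + t * (z ^+ 2 * v + t * (z * falling n u))) -
    t * ((z ^+ k)^-1 * z ^+ 2 * v + t * ((z ^+ k)^-1 * z * falling n u)) = u.
    by move: (z ^+ k) A0 (falling n u) => A A0 r; field.
  by rewrite y; congr vec3; move: (z ^+ k) A0 (falling n u) => A A0 r; field; rewrite A0 z0.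
- have A0 : z ^+ k != 0 by rewrite expf_neq0.
  by congr vec3; move: (falling n _) => r; move: (z ^+ k) A0 => A A0; field; rewrite ?A0 z0.
Qed.

Lemma df_transition (E : normedModType C) (T : E -> C) (F : E -> V3) b (x : E) :
  differentiable T x -> differentiable F x -> F x 0 0 != 0 ->
  differentiable (fun y => transition (T y) b (F y)) x.
Proof.
move=> dT dF z0; rewrite /transition; case: b => /=; apply: differentiable_vec3;
  by differentiable_tac.
Qed.

Lemma cn_transition m (E : normedModType C) (U : set E) (T : E -> C) (F : E -> V3) b :
  open U -> Cn_on m U T -> Cn_on m U F -> (forall x, U x -> F x 0 0 != 0) ->
  Cn_on m U (fun y => transition (T y) b (F y)).
Proof.
move=> oU HT HF z0; have H i := cn_coord oU i HF.
rewrite /transition; case: b => /=; apply: Cn_vec3 => //;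
  by repeat first [ assumption | exact: H | apply: CnD | apply: CnN | apply: CnM | apply: cn_X |
    apply: cn_falling
   | apply: CnV ].
Qed.

Definition base_coord (x : V3) : C := x 0 0.

Lemma base_coord_continuous : continuous base_coord. Proof. exact: coord_continuous. Qed.

Lemma transition_base_coord t b (x : V3) : base_coord x != 0 -> base_coord (transition t b x) =
  (base_coord x)^-1.
Proof. by move=> _; rewrite /base_coord transition_z. Qed.

Lemma transition_differentiable t b (x : V3) : base_coord x != 0 -> differentiable (transition t
  b) x.
Proof. by move=> x0; apply: (df_transition b (T := fun=> t) (F := id)). Qed.

Definition fiber_equiv t : equiv_rel (bool * V3) :=
  glue_equiv (@transition_base_coord t) (@transitionK t).

Lemma fiber_glue_data t : glue_data (fiber_equiv t) (transition t) (nonzero_dom base_coord).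
Proof. exact: glue_equiv_data base_coord_continuous _ _ (@transition_differentiable t). Qed.

Definition total_base_coord (p : V3 * C) : C := p.1 0 0.
Notation total_transition := (total_tau transition).

Lemma total_base_coord_continuous : continuous total_base_coord.
Proof.
move=> p; apply: (@continuous_comp _ _ _ fst base_coord); first exact: cvg_fst.
exact: base_coord_continuous.
Qed.

Lemma total_transition_base_coord b p : total_base_coord p != 0 -> total_base_coord
  (total_transition b p) = (total_base_coord p)^-1.
Proof. by move=> _; rewrite /total_base_coord transition_z. Qed.

Lemma total_transitionK b p : total_base_coord p != 0 -> total_transition (~~ b)
  (total_transition b p) = p.
Proof. by case: p => x t /= p0; rewrite /total_tau /= transitionK. Qed.

Lemma total_transition_differentiable b p : total_base_coord p != 0 -> differentiable
  (total_transition b) p.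
Proof.
move=> p0; apply: differentiable_pair; last first.
  by have := snd_is_diff p => ?; exact: ex_diff.
apply: (df_transition b (T := snd) (F := fst)) => //.
  by have := snd_is_diff p => ?; exact: ex_diff.
by apply: (@linear_differentiable _ _ _ fst) => q; exact: cvg_fst.
Qed.

Definition total_equiv : equiv_rel (bool * (V3 * C)) :=
  glue_equiv total_transition_base_coord total_transitionK.

Lemma total_glue_data : glue_data total_equiv total_transition (total_dom (nonzero_dom
  base_coord)).
Proof.
have -> : total_dom (nonzero_dom base_coord) = nonzero_dom total_base_coord.
  by apply/funext => b; apply/seteqP; split=> [p []|p] //.
exact: glue_equiv_data total_base_coord_continuous _ _ total_transition_differentiable.
Qed.

End Concrete.

(** * Smooth triviality of the family *)

Section Trivialization.
Variables (R : realType) (k n : nat).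
Hypothesis hk : (1 < k)%N.
Notation C := (Cplx R).
Notation V3 := 'rV[C]_3.

(** One member of the partition of unity; the other one is its value at 1/z, because 1/(1 +
|z|^(-2k)) = |z|^(2k) / (1 + |z|^(2k)). *)
Definition bump (z : C) : C := (1 + (z * cconj z) ^+ k)^-1.

Lemma bump_denom (z : C) : 1 + (z * cconj z) ^+ k != 0.
Proof.
rewrite mul_conj; have -> : ofR (cmod z ^+ 2) ^+ k = ofR ((cmod z ^+ 2) ^+ k).
  by rewrite -[RHS]/(real_complex R _) rmorphXn.
rewrite -ofR1 -ofRD ofR_eq0 gt_eqF // ltr_pwDl // exprn_ge0 // sqr_ge0 //.
Qed.

(** Two triangular changes of coordinates follow each other. The first one absorbs the cocycle t
z^-1 r_n(y) in the direction of u2, the second one the cocycle t z^(2-k) u2 of the extension of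
O(k-2) by O(-k), in the direction of u1. Chart true takes the part of the cocycle multiplied by
|z|^(2k) h, where h is [bump], and chart false the opposite of the rest, in terms of xi = 1/z. *)
Definition straighten (b : bool) (p : V3 * C) : V3 :=
  let z := p.1 0 0 in let t := p.2 in let s := cconj z ^+ k in let h := bump z in
  if b then
    let v := p.1 0 2 + t * (falling n (p.1 0 1) * (z ^+ k.-1 * (s * h))) in
    vec3 z (p.1 0 1 + t * (z ^+ 2 * (s * h) * v)) v
  else
    let r := falling n (z ^+ k * p.1 0 1 - t * p.1 0 2) in
    let v := p.1 0 2 - t * (r * (z ^+ k.-1 * (z ^+ k * (s * h)))) in
    vec3 z (p.1 0 1 - t * (t * (r * (z ^+ k.-1 * (s * h)))) - t * (s * h * v)) v.

(** The inverse of [straighten], the two triangular maps being undone in reverse order. In chart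
false the number y can be read from the intermediate coordinates because the first map preserves
it. *)
Definition unstraighten (b : bool) (p : V3 * C) : V3 :=
  let z := p.1 0 0 in let t := p.2 in let s := cconj z ^+ k in let h := bump z in
  let v := p.1 0 2 in
  if b then
    let u := p.1 0 1 - t * (z ^+ 2 * (s * h) * v) in
    vec3 z u (v - t * (falling n u * (z ^+ k.-1 * (s * h))))
  else
    let u := p.1 0 1 + t * (s * h * v) in
    let r := falling n (z ^+ k * u - t * v) in
    vec3 z (u + t * (t * (r * (z ^+ k.-1 * (s * h))))) (v + t * (r * (z ^+ k.-1 * (z ^+ k * (s *
      h))))).

Lemma straighten_z b p : straighten b p 0 0 = p.1 0 0.
Proof. by rewrite /straighten; case: b; rewrite vec3E. Qed.
Lemma unstraighten_z b p : unstraighten b p 0 0 = p.1 0 0.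
Proof. by rewrite /unstraighten; case: b; rewrite vec3E. Qed.

Lemma expr_pred (z : C) : z ^+ k = z * z ^+ k.-1.
Proof. by rewrite -exprS prednK // ltnW. Qed.

Lemma straightenK b (x : V3) (t : C) : unstraighten b (straighten b (x, t), t) = x.
Proof.
rewrite -[RHS]vec3_eta /unstraighten /straighten; case: b => /=; rewrite !vec3E.
  have E1 (a d : C) : a + d - d = a by ring.
  by rewrite E1; congr vec3; ring.
set z := x 0 0; set s := cconj z ^+ k; set h := bump z.
set r := falling n (z ^+ k * x 0 1 - t * x 0 2).
set v := x 0 2 - _.
have -> : z ^+ k * (x 0 1 - t * (t * (r * (z ^+ k.-1 * (s * h)))) - t * (s * h * v) + t * (s * h
  * v)) - t * v
   = z ^+ k * x 0 1 - t * x 0 2.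
  by rewrite /v; move: (z ^+ k) (z ^+ k.-1) => A B; ring.
by rewrite -/r /v; congr vec3; ring.
Qed.

Lemma unstraightenK b (x : V3) (t : C) : straighten b (unstraighten b (x, t), t) = x.
Proof.
rewrite -[RHS]vec3_eta /unstraighten /straighten; case: b => /=; rewrite !vec3E.
  set v := (X in vec3 _ _ X); have -> : v = x 0 2 by rewrite /v; ring.
  by congr vec3; ring.
set z := x 0 0; set s := cconj z ^+ k; set h := bump z.
set u := x 0 1 + _; set r := falling n (z ^+ k * u - t * x 0 2).
have -> : z ^+ k * (u + t * (t * (r * (z ^+ k.-1 * (s * h))))) - t * (x 0 2 + t * (r * (z ^+ k.-1
  * (z ^+ k * (s * h)))))
  = z ^+ k * u - t * x 0 2.
  by move: (z ^+ k) (z ^+ k.-1) => A B; ring.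
rewrite -/r; set v := (X in vec3 _ _ X); have -> : v = x 0 2 by rewrite /v; ring.
by rewrite /u; congr vec3; ring.
Qed.

Notation tau0 := (W_glue (R := R) k).

Lemma W_glueE (x : V3) : x 0 0 != 0 -> W_glue k x =
  vec3 (x 0 0)^-1 (x 0 0 ^+ k * x 0 1) ((x 0 0)^-1 ^+ k * x 0 0 ^+ 2 * x 0 2).
Proof.
move=> z0; rewrite /W_glue; congr vec3; congr (_ * _).
by rewrite expfzDr // -exprnN exprVn.
Qed.

Lemma transition_W_glue b (x : V3) : x 0 0 != 0 -> W_glue k x = transition k n 0 b x.
Proof.
move=> z0; rewrite (W_glueE z0) /transition; case: b; congr vec3;
  by rewrite !mul0r ?addr0 ?oppr0 ?addr0.
Qed.

Lemma cconjV (z : C) : cconj z^-1 = (cconj z)^-1.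
Proof. exact: (fmorphV (@conjc R)). Qed.

(** After replacing y by u1, the identity is rational in z, z^(k-1), conj(z)^k, r_n(u1) and the
coordinates. *)
Lemma straighten_glue_true (x : V3) (t : C) : x 0 0 != 0 ->
  straighten false (transition k n t true x, t) = W_glue k (straighten true (x, t)).
Proof.
move=> z0; rewrite W_glueE ?straighten_z // /straighten /transition /= !vec3E.
move: (bump_denom (x 0 0)) (bump_denom (x 0 0)^-1).
rewrite /bump !cconjV !exprMn !exprVn !expr_pred.
have : cconj (x 0 0) != 0.
  by apply: contraNneq z0 => c0; have := mul_conj (x 0 0); rewrite c0 mulr0 => /esym/eqP;
   rewrite ofR_eq0 expf_eq0 /= cmod_eq0.
move: (x 0 0) (x 0 1) (x 0 2) z0 => z u v z0.
have Z0 : z ^+ k.-1 != 0 by rewrite expf_neq0.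
move: (z ^+ k.-1) Z0 => Z Z0; move: (cconj z) => s0 /[dup] s0N /(expf_neq0 k.-1).
move: (s0 ^+ k.-1) => S S0 D1 D2.
have y : (z * Z)^-1 * (z * Z * u + t * (z ^+ 2 * v + t * (z * falling n u))) -
     t * ((z * Z)^-1 * z ^+ 2 * v + t * ((z * Z)^-1 * z * falling n u)) = u.
  by move: (falling n u) => r; field; rewrite Z0 z0.
rewrite y; move: (mulf_neq0 s0N S0); move: (falling n u) (s0 * S) D1 D2 => r q D1 D2 q0.
have hE : q^-1 / (1 + (z * Z)^-1 / q) = z * Z / (1 + z * Z * q).
  have D3 : z * Z * q + 1 != 0 by rewrite addrC.
  by field; rewrite ?Z0 ?z0 ?q0 ?D1 ?D3.
rewrite hE; congr vec3; field; by rewrite ?Z0 ?z0 ?D1.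
Qed.

Lemma straighten_glue b (x : V3) (t : C) : x 0 0 != 0 ->
  straighten (~~ b) (transition k n t b x, t) = W_glue k (straighten b (x, t)).
Proof.
case: b => z0; first exact: straighten_glue_true.
have w0 : transition k n t false x 0 0 != 0 by rewrite transition_z invr_eq0.
have := straighten_glue_true t w0; rewrite -[true]/(~~ false) transitionK // => ->.
by rewrite W_glueK // straighten_z.
Qed.

Lemma bump_smooth m : Cn_on m [set: V3 * C] (fun p => bump (p.1 0 0)).
Proof.
have oT := @openT (V3 * C)%type.
have Hz : Cn_on m [set: V3 * C] (fun p : V3 * C => p.1 0 0).
  exact: (cn_coord (F := fst) oT 0 (Cn_rlin _ oT (real_linear_fst _ _))).
apply: CnV => //; first by move=> p _; exact: bump_denom.
apply: CnD => //; first exact: Cn_cst.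
by apply: cn_X => //; apply: CnM => //; exact: cn_conj.
Qed.

Ltac smooth_tac oT := repeat first [ assumption | apply: (CnD oT) | apply: (CnN oT) | apply: (CnM
  oT) | apply: (cn_X oT)
   | apply: (cn_falling oT) | apply: (Cn_vec3 oT) | apply: bump_smooth ].

Lemma straighten_smooth b m : Cn_on m [set: V3 * C] (straighten b).
Proof.
have oT := @openT (V3 * C)%type.
have H i : Cn_on m [set: V3 * C] (fun p : V3 * C => p.1 0 i).
  exact: (cn_coord (F := fst) oT i (Cn_rlin _ oT (real_linear_fst _ _))).
have Ht : Cn_on m [set: V3 * C] (fun p : V3 * C => p.2) := Cn_rlin _ oT (real_linear_snd _ _).
have Hc := cn_conj oT (H 0).
have H0 := H 0; have H1 := H 1; have H2 := H 2.
by rewrite /straighten; case: b; smooth_tac oT.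
Qed.

Lemma unstraighten_smooth b m : Cn_on m [set: V3 * C] (unstraighten b).
Proof.
have oT := @openT (V3 * C)%type.
have H i : Cn_on m [set: V3 * C] (fun p : V3 * C => p.1 0 i).
  exact: (cn_coord (F := fst) oT i (Cn_rlin _ oT (real_linear_fst _ _))).
have Ht : Cn_on m [set: V3 * C] (fun p : V3 * C => p.2) := Cn_rlin _ oT (real_linear_snd _ _).
have Hc := cn_conj oT (H 0).
have H0 := H 0; have H1 := H 1; have H2 := H 2.
by rewrite /unstraighten; case: b; smooth_tac oT.
Qed.

Lemma open_base_coord_neq0 (F : V3 * C -> V3) : (forall m, Cn_on m [set: V3 * C] F) ->
  open [set p | F p 0 0 != 0].
Proof.
move=> sF; have /continuousP : continuous (fun p => F p 0 0).
  move=> p; have oT := @openT (V3 * C)%type.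
  exact: (Cn_continuous (cn_coord oT 0 (sF 0%N))).
by move=> /(_ _ (@open_neqC R 0)).
Qed.

Lemma transition_smooth (F : V3 * C -> V3) (T : V3 * C -> C) b m :
  (forall m, Cn_on m [set: V3 * C] F) -> (forall m, Cn_on m [set: V3 * C] T) ->
  Cn_on m [set p | F p 0 0 != 0] (fun p => transition k n (T p) b (F p)).
Proof.
move=> sF sT; apply: cn_transition; first exact: open_base_coord_neq0.
- exact: Cn_sub (sT m).
- exact: Cn_sub (sF m).
- by [].
Qed.

(** This makes W_k an instance of the general gluing. *)
Lemma W_glue_data : glue_data (W_equiv_rel R k) (fun _ => W_glue k) (nonzero_dom (@base_coord R)).
Proof.
have ct (b : bool) (x : V3) : base_coord x != 0 -> base_coord (W_glue k x) = (base_coord x)^-1.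
  by move=> _; rewrite /base_coord /W_glue vec3E.
apply: (glue_data_intro (@base_coord_continuous R) ct).
- by move=> b x x0; exact: W_glueK.
- move=> b x x0; apply: near_differentiable (transition_differentiable k n 0 b x0).
  have n0 : nbhs x [set y : V3 | base_coord y != 0].
    apply: (@base_coord_continuous R x [set z | z != 0]).
    by apply: open_nbhs_nbhs; split; [exact: open_neqC|].
  by apply: filterS n0 => y y0; rewrite (transition_W_glue b).
- move=> [b x] [c y]; rewrite -[_ (b, x) (c, y)]/(W_rel k (b, x) (c,
    y)) /W_rel /nonzero_dom /base_coord /=.
  split.
    case/or3P => [/eqP ->|/and4P[b1 c1 x0 /eqP ->]|/and4P[c1 b1 y0 /eqP ->]].
    + by left.
    + by right; split=> //; move: b1 c1; case: (b); case: (c).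
    + right; rewrite W_glueK //; split=> //; last by rewrite /= W_glue_neq0.
      by move: b1 c1; case: (b); case: (c).
  case=> [->|[/= -> x0 ->]]; first by rewrite eqxx.
  case: b => /=; first by rewrite x0 eqxx ?orbT.
  by rewrite W_glue_neq0 x0 W_glueK // eqxx ?orbT.
Qed.

Definition deformed_W : atlased V3 := glued (fiber_equiv (R := R) k n 1) (transition k n 1).

Theorem deformed_W_is_deformation : is_deformation (W R k) deformed_W.
Proof.
exists (V3 * C)%type, C, (glued (total_equiv R k n) (total_tau (transition k n))), [set: C],
  (total_proj (tauF := transition k n) (e' := total_equiv R k n)), 1.
have TD := total_glue_data R k n.
split=> //.
- exact: complete_prod (@complete_rV3 R) (@complete_C R).
- exact: complete_C.
- apply: (@total_deformation_family R _ _ (nonzero_dom (@base_coord R)) (transition k n) _ TD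
    _ _ W_glue_data straighten unstraighten _ _ _ _ _ _ _ _ _ 0) => //.
  + by move=> b x t; exact: straighten_glue.
  + by move=> b x t; rewrite /nonzero_dom /base_coord /= straighten_z.
  + by move=> b x t; rewrite /nonzero_dom /base_coord /= unstraighten_z.
  + by move=> b x t; exact: straightenK.
  + by move=> b x t; exact: unstraightenK.
  + by move=> b m; exact: straighten_smooth.
  + by move=> b m; exact: unstraighten_smooth.
  + move=> b m.
    have oU := open_base_coord_neq0 (straighten_smooth b).
    have := @transition_smooth (straighten b) (fun=> 0) b m (straighten_smooth b) (fun m =>
      Cn_cst _ _ openT).
    by apply: Cn_ext => // p p0; rewrite (transition_W_glue b).
  + move=> b m; apply: (@transition_smooth (unstraighten b) snd b m (unstraighten_smooth b)) =>
      m'.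
    exact: (Cn_rlin _ openT (real_linear_snd _ _)).
  + by move=> b x x0; exact: transition_W_glue.
- exact: (total_fiber TD (fiber_glue_data k n 1)).
Qed.

End Trivialization.

(** * Holomorphic spheres *)

Section HolomorphicMaps.
Variables (R : realType).
Notation C := (Cplx R).

(** Holomorphy is a statement about all charts; at each point one chart of N serves to factor
the coordinate expression of the composition. *)
Lemma holomorphic_comp (E F H : normedModType C) (M : atlased E) (N : atlased F) (P : atlased H)
  (f : M -> N) (g : N -> P) :
  is_complex_manifold M -> is_complex_manifold N ->
  holomorphic f -> holomorphic g -> holomorphic (g \o f).
Proof.
move=> mM mN [cf hf] [cg hg]; split.
  by move=> x; apply: continuous_comp; [exact: cf|exact: cg].
move=> c d ac ad x _ cx dx.
have [e ae ex] := manifold_cover mN (f x).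
have cc := manifold_charts mM ac; have ce := manifold_charts mN ae.
have cxK : chart_inv c (c x) = x by apply: (chart_funK cc); rewrite inE.
have hf1 := hf c e ac ae x I cx ex.
have hg1 := hg e d ae ad (f x) I ex dx.
apply: (@near_differentiable _ _ _ ((d \o g \o chart_inv e) \o (e \o f \o chart_inv c))).
  have cfc : {for c x, continuous (f \o chart_inv c)}.
    apply: continuous_comp; first by apply: (chart_inv_continuous cc); exists x.
    by rewrite cxK; exact: cf.
  have : nbhs (c x) ((f \o chart_inv c) @^-1` chart_dom e).
    apply: cfc; apply: open_nbhs_nbhs; split; first exact: (chart_dom_open ce).
    by rewrite /= cxK.
  by apply: filterS => y ey /=; rewrite (chart_funK ce) // inE.
apply: differentiable_comp; first exact: hf1.
by rewrite /= cxK.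
Qed.

(** A holomorphic map from the Riemann sphere, given by its restrictions to its two affine
charts. *)
Definition sphere (E : normedModType C) (M : atlased E) (a b : model (C : normedModType C) -> M)
  : Prop :=
  [/\ holomorphic a, holomorphic b & forall z : C, z != 0 -> a z = b z^-1].

Lemma sphere_comp (E F : normedModType C) (M : atlased E) (N : atlased F)
  (f : M -> N) a b : is_complex_manifold M -> holomorphic f -> sphere a b ->
  sphere (M := N) (f \o a) (f \o b).
Proof.
move=> mM hf [ha hb ab]; have mC := @model_manifold R C; split.
- exact: holomorphic_comp ha hf.
- exact: holomorphic_comp hb hf.
- by move=> z z0 /=; rewrite ab.
Qed.

Section Glued.
Variables (E : normedModType C) (e : equiv_rel (bool * E)) (tau : bool -> E -> E) (O : bool ->
  set E).
Hypothesis G : glue_data e tau O.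
Notation M := (glued e tau).

Lemma pullback_differentiable (g : M -> C) (a : model (C : normedModType C) -> M) :
  (forall b x, differentiable (fun y => g (glued_class e (b, y))) x) ->
  holomorphic a -> forall z : C, differentiable (g \o a : C -> C) z.
Proof.
move=> dg [ca ha] z; have [b [x ax]] := glued_class_surj (a z).
have dz : chart_dom (glued_chart e tau b) (a z) by rewrite ax; exact: glued_class_dom.
have H := ha (Chart [set: C] id id) (glued_chart e tau b) erefl (glued_chart_atlas e tau b) z I I
  dz.
apply: (@near_differentiable _ _ _ ((fun y => g (glued_class e (b,
  y))) \o (glued_chart e tau b \o a))).
  have : nbhs z (a @^-1` chart_dom (glued_chart e tau b)).
    by apply: ca; apply: open_nbhs_nbhs; split=> //;
      exact: (chart_dom_open (glued_chart_is_chart G b)).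
  apply: filterS => y [x' _ ay].
  rewrite -[LHS]/(g (glued_class e (b, glued_chart e tau b (a y)))) -[RHS]/(g (a y)).
  by rewrite -ay (glued_chartK G).
by apply: differentiable_comp; [exact: H|exact: dg].
Qed.

Lemma chart_curve_holomorphic b (A : C -> E) : (forall z, differentiable A z) ->
  holomorphic (M := model (C : normedModType C)) (N := M) (fun z => glued_class e (b, A z)).
Proof.
move=> dA; have cA : continuous A by move=> z; exact: differentiable_continuous (dA z).
split.
  move=> z; apply: (@continuous_comp _ _ _ A (fun x => glued_class e (b, x))); first exact: cA.
  exact: (glued_class_continuous G).
move=> c d /model_atlas -> /glued_atlas [b' ->] z _ _.
have [->|bb] := eqVneq b' b.
  move=> _; rewrite (_ : _ \o _ = A); first exact: dA.
  by apply/funext => y; rewrite -[LHS]/(glued_chart e tau b (glued_class e (b,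
    A y))) (glued_chartK G).
have -> := neq_negb bb.
move=> /(glued_class_domN G) Oz.
apply: (@near_differentiable _ _ _ (tau b \o A)); last first.
  by apply: differentiable_comp; [exact: dA|exact: (glue_diff G)].
have : nbhs z (A @^-1` O b).
  by apply: cA; apply: open_nbhs_nbhs; split=> //; exact: (glue_open G).
apply: filterS => y Oy; rewrite -[RHS]/(glued_chart e tau (~~ b) (glued_class e (b, A y))).
by rewrite (glued_chartN G).
Qed.
End Glued.
End HolomorphicMaps.

(** * Spheres in the deformations *)

Section Curves.
Variables (R : realType) (k : nat).
Hypothesis hk : (1 < k)%N.
Notation C := (Cplx R).
Notation V3 := 'rV[C]_3.
Notation X n := (deformed_W R k n).
Notation cls n := (glued_class (fiber_equiv (R := R) k n 1)).

(** The four global functions y, w, zw and w' in each chart, numbered from 0. In chart false,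
w = xi^2 v1 - xi r_n(y) and zw = xi v1 - r_n(y), which shows that they have no pole at xi = 0. *)
Definition global_coord (n : nat) (j : nat) (b : bool) (x : V3) : C :=
  let z := x 0 0 in
  if b then
    let w := x 0 2 + z ^+ (k - 2) * x 0 1 in
    match j with 0 => x 0 1 | 1 => w | 2 => z * w | _ => z ^+ 2 * w + z * falling n (x 0 1) end
  else
    let y := z ^+ k * x 0 1 + - x 0 2 in
    match j with 0 => y | 1 => z ^+ 2 * x 0 1 + - (z * falling n y)
    | 2 => z * x 0 1 + - falling n y | _ => x 0 1 end.

Lemma global_coord_differentiable n j b x : differentiable (global_coord n j b) x.
Proof.
have d0 : differentiable (fun x : V3 => x) x by exact: ex_diff.
by rewrite /global_coord; case: b; case: j => [|[|[|j]]]; differentiable_tac.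
Qed.

Lemma expr_sub2 (z : C) : z ^+ k = z ^+ 2 * z ^+ (k - 2).
Proof. by rewrite -exprD subnKC. Qed.

Lemma global_coord_glue n j b (x : V3) : base_coord x != 0 -> global_coord n j (~~ b) (transition
  k n 1 b x) = global_coord n j b x.
Proof.
have main y : base_coord y != 0 -> global_coord n j false (transition k n 1 true y) =
  global_coord n j true y.
  rewrite /base_coord /global_coord /transition /= !vec3E exprVn expr_sub2.
  move: (y 0 0) (y 0 1) (y 0 2) => z u v z0.
  have Z0 : z ^+ (k - 2) != 0 by rewrite expf_neq0.
  move: (z ^+ (k - 2)) Z0 => Z Z0.
  have -> : (z ^+ 2 * Z)^-1 * (z ^+ 2 * Z * u + 1 * (z ^+ 2 * v + 1 * (z * falling n u))) +
    - ((z ^+ 2 * Z)^-1 * z ^+ 2 * v + 1 * ((z ^+ 2 * Z)^-1 * z * falling n u)) = u.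
    by move: (falling n u) => r; field; rewrite Z0 z0.
  by move: (falling n u) => r; case: j => [|[|[|_]]] //; field; rewrite ?Z0 ?z0.
case: b => x0; first exact: main.
rewrite -[in RHS](@transitionK R k n 1 false x x0) main //.
by rewrite /base_coord transition_z invr_eq0.
Qed.

Definition global_fun n j (w : X n) : C :=
  let p := repr (w : {eq_quot (fiber_equiv (R := R) k n 1)}) in global_coord n j p.1 p.2.

Arguments global_fun : clear implicits.

Lemma global_funE n j b x : global_fun n j (cls n (b, x)) = global_coord n j b x.
Proof. by apply: (glued_liftE (fiber_glue_data k n 1) (f := global_coord n j)) => c y y0;
  exact: global_coord_glue. Qed.

Lemma sphere_const n j a b : sphere (M := X n) a b -> forall z, global_fun n j (a z) =
  global_fun n j (b 0).
Proof.
move=> [ha hb ab] z.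
have dG c x : differentiable (fun y => global_fun n j (cls n (c, y))) x.
  rewrite (_ : (fun _ => _) = global_coord n j c); first exact: global_coord_differentiable.
  by apply/funext => y; rewrite global_funE.
apply: (@sphere_function_constant R (global_fun n j \o a) (global_fun n j \o b)).
- exact: (pullback_differentiable (fiber_glue_data k n 1) dG ha).
- exact: (pullback_differentiable (fiber_glue_data k n 1) dG hb).
- by move=> t t0 /=; rewrite ab.
Qed.

(** For two points of chart true, equality of w, zw and w' gives (z - z') w = 0 and then
(z - z') r_n(y) = 0, while z = z' would make the points equal; chart false is similar. Points of
different charts reduce to the same chart unless z = 0, and then zw = w' = 0 forces r_n(y) = 0. *)
Lemma global_fun_separates n (p q : X n) : (forall j, global_fun n j p =
  global_fun n j q) -> p <> q ->
  falling n (global_fun n 0 p) = 0 /\ forall j, global_fun n j.+1 p = 0.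
Proof.
have fin b (x : V3) : falling n (global_coord n 0 b x) = 0 -> global_coord n 1 b x =
  0 -> global_coord n 2 b x = 0 -> global_coord n 3 b x = 0 ->
   falling n (global_fun n 0 (cls n (b, x))) = 0 /\ forall j, global_fun n j.+1 (cls n (b, x)) =
     0.
  move=> h0 h1 h2 h3; split; first by rewrite global_funE.
  by move=> j; rewrite global_funE; case: j => [|[|j]] //; move: h3; rewrite /global_coord;
    case: b.
have TT (x x' : V3) : (forall j, global_coord n j true x = global_coord n j true x') -> x <> x' ->
   falling n (global_fun n 0 (cls n (true, x))) = 0 /\ forall j, global_fun n j.+1 (cls n (true,
     x)) = 0.
  move=> H xx'; have := H 0%N; have := H 1%N; have := H 2%N; have := H 3%N.
  rewrite /global_coord /=; set w := x 0 2 + _; set w' := x' 0 2 + _ => h3 h2 h1 h0.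
  have zz : x 0 0 - x' 0 0 != 0.
    rewrite subr_eq0; apply/eqP => e0; apply: xx'.
    rewrite -[x]vec3_eta -[x']vec3_eta; congr vec3 => //.
    have : x 0 2 = w - x 0 0 ^+ (k - 2) * x 0 1 by rewrite /w addrK.
    by rewrite h1 /w' e0 h0 addrK.
  have w0 : w = 0.
    by apply: (mulfI zz); rewrite mulrBl h2 h1 subrr mulr0.
  have r0 : falling n (x 0 1) = 0.
    apply: (mulfI zz); rewrite mulr0 mulrBl.
    by move: h3; rewrite -h1 w0 !mulr0 !add0r -h0 => ->; rewrite subrr.
  by apply: fin; rewrite /global_coord /= -?/w ?w0 ?r0 ?mulr0 ?addr0.
have FF (x x' : V3) : (forall j, global_coord n j false x =
  global_coord n j false x') -> x <> x' ->
   falling n (global_fun n 0 (cls n (false, x))) =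
     0 /\ forall j, global_fun n j.+1 (cls n (false, x)) = 0.
  move=> H xx'; have := H 0%N; have := H 1%N; have := H 2%N; have := H 3%N.
  rewrite /global_coord /=; set y := _ + - x 0 2; set y' := _ + - x' 0 2 => h3 h2 h1 h0.
  have zz : x 0 0 - x' 0 0 != 0.
    rewrite subr_eq0; apply/eqP => e0; apply: xx'.
    rewrite -[x]vec3_eta -[x']vec3_eta; congr vec3 => //.
    have : x 0 2 = x 0 0 ^+ k * x 0 1 - y by rewrite /y; ring.
    by move=> ->; rewrite h0 h3 e0 /y'; ring.
  have v0 : x 0 1 = 0.
    apply: (mulfI zz); rewrite mulr0 mulrBl {2}h3.
    by move: h2; rewrite h0 => /addIr ->; rewrite subrr.
  have r0 : falling n y = 0.
    apply: (mulfI zz); rewrite mulr0 mulrBl.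
    move: h1; rewrite -h3 v0 !mulr0 !add0r -h0 => /oppr_inj ->; by rewrite subrr.
  by apply: fin; rewrite /global_coord /= -?/y ?v0 ?r0 ?mulr0 ?oppr0 ?addr0.
have TF (x x' : V3) : (forall j, global_coord n j true x =
  global_coord n j false x') -> cls n (true, x) <> cls n (false, x') ->
   falling n (global_fun n 0 (cls n (true, x))) = 0 /\ forall j, global_fun n j.+1 (cls n (true,
     x)) = 0.
  move=> H ne; have [z0|z0] := eqVneq (x 0 0) 0.
    have v0 := H 3%N; have r0 := H 2%N; have w0 := H 1%N; have y0 := H 0%N.
    move: v0 r0 w0 y0; rewrite /global_coord /= z0 expr0n /= !mul0r addr0.
    set y := _ + - x' 0 2 => /esym v0; rewrite v0 mulr0 add0r => /esym/eqP.
    rewrite oppr_eq0 => /eqP r0; rewrite r0 !mulr0 oppr0 addr0 => w0 y0.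
    by apply: fin; rewrite /global_coord /= ?z0 ?w0 ?expr0n /= ?mul0r ?addr0 ?y0.
  have E1 := glued_class_glue (fiber_glue_data k n 1) (b := true) (x := x) z0.
  move: ne; rewrite -E1 => ne.
  apply: (FF _ x'); last by move=> h; apply: ne; rewrite h.
  by move=> j; rewrite -H -[false]/(~~ true) global_coord_glue.
have [b [x ->]] := glued_class_surj p; have [c [x' ->]] := glued_class_surj q.
move=> H ne; have {}H j : global_coord n j b x = global_coord n j c x' by have := H j;
  rewrite !global_funE.
move: b c H ne => [] [] H ne.
- by apply: (TT x x') => // h; apply: ne; rewrite h.
- exact: TF H ne.
- have [||r0 h] := TF x' x; [by move=> j; rewrite H|by apply/nesym|].
  by apply: fin; rewrite H -global_funE.
- by apply: (FF x x') => // h; apply: ne; rewrite h.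
Qed.

(** The curve w = w' = 0 over a root c of r_n, with its affine chart at infinity
[zero_curve_inf]. *)
Definition zero_curve n (c : C) (z : C) : X n := cls n (true, vec3 z c (- (z ^+ (k - 2) * c))).
Definition zero_curve_inf n (c : C) (z : C) : X n := cls n (false, vec3 z 0 (- c)).

Lemma zero_curve_sphere n c : falling n c = 0 -> sphere (M :=
  X n) (zero_curve n c) (zero_curve_inf n c).
Proof.
move=> r0.
have di (z : C) : differentiable (fun z : C => z) z by exact: ex_diff.
split.
- apply: (chart_curve_holomorphic (fiber_glue_data k n 1)) => z.
  by have d0 := di z; apply: differentiable_vec3; differentiable_tac.
- apply: (chart_curve_holomorphic (fiber_glue_data k n 1)) => z.
  by have d0 := di z; apply: differentiable_vec3; differentiable_tac.
move=> z z0; rewrite /zero_curve /zero_curve_inf.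
rewrite -(glued_class_glue (fiber_glue_data k n 1));
  last by rewrite /nonzero_dom /base_coord /= vec3E.
congr (glued_class _ (_, _)); rewrite /transition /= !vec3E r0 expr_sub2 exprVn expr_sub2.
have Z0 : z ^+ (k - 2) != 0 by rewrite expf_neq0.
move: (z ^+ (k - 2)) Z0 => Z Z0.
by congr vec3; field; rewrite ?Z0 ?z0.
Qed.

Lemma global_fun_zero_curve n c z : global_fun n 0 (zero_curve n c z) = c.
Proof. by rewrite global_funE /global_coord /= vec3E. Qed.

Lemma zero_curve_inj n c (z z' : C) : zero_curve n c z = zero_curve n c z' -> z = z'.
Proof. by move=> /(glued_class_same (fiber_glue_data k n 1)) /(congr1 (fun x : V3 => x 0 0));
  rewrite !vec3E. Qed.

Lemma zero_globals_on_curve n c (p : X n) : falling n c = 0 -> global_fun n 0 p =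
  c -> (forall j, global_fun n j.+1 p = 0) ->
  (exists z, p = zero_curve n c z) \/ p = zero_curve_inf n c 0.
Proof.
move=> r0; have [b [x ->]] := glued_class_surj p; rewrite global_funE => y0 H.
have {}H j : global_coord n j.+1 b x = 0 by rewrite -global_funE.
case: b y0 H => y0 H.
  left; exists (x 0 0); rewrite /zero_curve -[x in LHS]vec3_eta;
    congr (glued_class _ (_, vec3 _ _ _)); first exact: y0.
  by have := H 0%N; rewrite -y0 /global_coord /= => /eqP; rewrite addr_eq0 => /eqP.
have v0 : x 0 1 = 0 by have := H 2%N.
have v2 : x 0 2 = - c by rewrite -y0 /global_coord /= v0 mulr0 add0r opprK.
have xE : x = vec3 (x 0 0) 0 (- c) by rewrite -[LHS]vec3_eta v0 v2.
have [z0|z0] := eqVneq (x 0 0) 0; first by right; rewrite xE z0.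
left; exists (x 0 0)^-1.
have [_ _ ->] := zero_curve_sphere r0; last by rewrite invr_eq0.
by rewrite invrK /zero_curve_inf -xE.
Qed.

Lemma falling_root n (c : C) : falling n c = 0 -> exists i : 'I_n, c = i%:R.
Proof.
move=> /eqP /prodf_eq0 [i _]; rewrite subr_eq0 => /eqP ->.
by exists i.
Qed.

Lemma falling_nat n (i : 'I_n) : falling n (i%:R : C) = 0.
Proof. by rewrite /falling (bigD1 i) //= subrr mul0r. Qed.

Lemma deformed_W_manifold n : is_complex_manifold (X n).
Proof. exact: glued_manifold (fiber_glue_data k n 1). Qed.

(** A map from m to n letters is not injective: two spheres of X_m go to the same sphere of X_n,
whose inverse image carries two values of y although y is constant on each sphere. *)
Lemma no_biholomorphism m n : (n < m)%N -> ~ biholomorphic (X m) (X n).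
Proof.
move=> nm [f [g [hf hg fK gK]]].
have key (i : 'I_m) : exists j : 'I_n, global_fun n 0 (f (zero_curve m i%:R 0)) = j%:R /\
   forall l, global_fun n l.+1 (f (zero_curve m i%:R 0)) = 0.
  have S := sphere_comp (deformed_W_manifold m) hf (zero_curve_sphere (falling_nat i)).
  have [] := @global_fun_separates n (f (zero_curve m i%:R 0)) (f (zero_curve m i%:R 1)).
  - move=> j; have c0 := sphere_const j S 0; have c1 := sphere_const j S 1.
    exact: etrans c0 (esym c1).
  - move=> /(can_inj fK) /zero_curve_inj /eqP; by rewrite eq_sym oner_eq0.
  by move=> /falling_root [j ->] H; exists j.
(* phi sends a sphere of the source to the root over which its image lies. *)
have [phi Hphi] := choice key.
have [i1 [i2 [ne e12]]] : exists i1 i2, i1 <> i2 /\ phi i1 = phi i2.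
  apply: contrapT => H; have inj : injective phi.
    by move=> i1 i2 e12; apply: contrapT => ne; apply: H; exists i1, i2.
  by have := leq_card phi inj; rewrite !card_ord leqNgt nm.
have [y1 H1] := Hphi i1; have [y2 H2] := Hphi i2.
have r0 := falling_nat (phi i1).
have S := sphere_comp (deformed_W_manifold n) hg (zero_curve_sphere r0).
have on p : global_fun n 0 p = (phi i1)%:R -> (forall l, global_fun n l.+1 p = 0) ->
    global_fun m 0 (g p) = global_fun m 0 (g (zero_curve_inf n (phi i1)%:R 0)).
  move=> yp Hp; have [[z ->]|->] := zero_globals_on_curve r0 yp Hp => //.
  exact: (sphere_const 0 S z).
have E1 := on _ y1 H1; rewrite -e12 in y2; have E2 := on _ y2 H2.
move: E1; rewrite -E2 !fK !global_fun_zero_curve => /eqP; rewrite eqr_nat => /eqP /val_inj.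
exact: ne.
Qed.

End Curves.

Theorem theorem1p25 (R : realType) (k : nat) (hk : (1 < k)%N) :
  exists X : nat -> atlased 'rV[Cplx R]_3,
    (forall n, is_deformation (W R k) (X n)) /\
    (forall m n, m <> n -> ~ biholomorphic (X m) (X n)).
Proof.
exists (deformed_W R k); split=> [n|m n mn]; first exact: deformed_W_is_deformation.
have [lt|lt|//] := ltngtP m n; last exact: no_biholomorphism.
move=> [f [g [hf hg fK gK]]]; apply: (no_biholomorphism hk lt).
by exists g, f.
Qed.
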